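(* Let $\star$ be a nontrivial semistar operation of an integral domain $D$. Assume that $\star = \star_f$. Let $\star_a$ be the e.a.b. semistar operation of finite type canonically associated to $\star$. (1) Let $(W,N)$ be a nontrivial valuation overring of $\mathrm{Kr}(D,\star)$ (with maximal ideal $N$). Set $N_0 := N \cap D$ and $N_1 := N \cap D[X]$. Then: (a) $N_1 = N_0[X]$, $N \cap \mathrm{Na}(D,\star) = N_0\mathrm{Na}(D,\star) = N_1\mathrm{Na}(D,\star)$, and $N \cap \mathrm{Na}(D,\star_a) = N_0\mathrm{Na}(D,\star_a) = N_1\mathrm{Na}(D,\star_a)$; (b) $N_0$ is a quasi-$\star_a$-prime ideal (in particular, a quasi-$\star$-prime ideal) of $D$. (2) If $P$ is a quasi-$\star_a$-prime ideal of $D$, then there exist a quasi-$\star_a$-maximal ideal $Q$ of $D$ and a valuation overring $(W,N)$ of $\mathrm{Kr}(D,\star)$ such that $P \subseteq Q = N \cap D$. (3) $\mathcal{M}(\star_a)$ is contained in the canonical image in $\mathrm{Spec}(D)$ of $\mathrm{Max}(\mathrm{Kr}(D,\star))$ (under contraction to $D$). (4) For each $Q \in \mathcal{M}(\star_a)$, there exists a $\star$-valuation overring $(V,M)$ of $D$ dominating $D_Q$.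
   Context: $D$ is an integral domain with quotient field $K$. $\overline{\boldsymbol{F}}(D)$ is the set of nonzero $D$-submodules of $K$, and $\boldsymbol{f}(D)$ the set of nonzero finitely generated $D$-submodules of $K$. A semistar operation of $D$ is a map $\star : \overline{\boldsymbol{F}}(D) \to \overline{\boldsymbol{F}}(D)$, $E \mapsto E^\star$, such that for all $0 \neq z \in K$ and all $E, F \in \overline{\boldsymbol{F}}(D)$: $(zE)^\star = zE^\star$; $E \subseteq F \Rightarrow E^\star \subseteq F^\star$; $E \subseteq E^\star$ and $(E^\star)^\star = E^\star$. It is trivial if $E^\star = K$ for all $E$ (equivalently $D^\star = K$), and nontrivial otherwise. $E^{\star_f} := \bigcup\{F^\star \mid F \subseteq E,\ F \in \boldsymbol{f}(D)\}$; $\star$ is of finite type if $\star = \star_f$. For a semistar operation $\ast$, a quasi-$\ast$-ideal is a nonzero ideal $I \subseteq D$ with $I^\ast \cap D = I$; a quasi-$\ast$-prime is a quasi-$\ast$-ideal that is a prime ideal; a quasi-$\ast$-maximal ideal is a maximal element of the set of all proper quasi-$\ast$-ideals. For $\ast$ of finite type, $\mathcal{M}(\ast)$ is the set of quasi-$\ast$-maximal ideals of $D$. $\star$ is e.a.b. if for all $E,F,G \in \boldsymbol{f}(D)$, $(EF)^\star \subseteq (EG)^\star$ implies $F^\star \subseteq G^\star$. The e.a.b. semistar operation of finite type $\star_a$ associated to $\star$ is: $F^{\star_a} := \bigcup\{((FH)^\star : H^\star) \mid H \in \boldsymbol{f}(D)\}$ for $F \in \boldsymbol{f}(D)$ (where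 $(A:B) = \{z \in K \mid zB \subseteq A\}$), and $E^{\star_a} := \bigcup\{F^{\star_a} \mid F \subseteq E,\ F \in \boldsymbol{f}(D)\}$ for $E \in \overline{\boldsymbol{F}}(D)$. $\boldsymbol{c}(h)$ is the ideal of $D$ generated by the coefficients of $h \in D[X]$. For a semistar operation $\ast$: $\mathrm{Na}(D,\ast) := \{f/g \mid f,g \in D[X],\ g \neq 0,\ \boldsymbol{c}(g)^\ast = D^\ast\}$ and $\mathrm{Kr}(D,\ast) := \{f/g \mid f,g \in D[X]\setminus\{0\} \text{ and there exists } h \in D[X]\setminus\{0\} \text{ with } (\boldsymbol{c}(f)\boldsymbol{c}(h))^\ast \subseteq (\boldsymbol{c}(g)\boldsymbol{c}(h))^\ast\} \cup \{0\}$, subrings of $K(X)$ with $\mathrm{Na}(D,\ast) \subseteq \mathrm{Kr}(D,\ast)$; $\mathrm{Kr}(D,\ast)$ has quotient field $K(X)$. A valuation overring is nontrivial if it is not the quotient field. A $\star$-valuation overring of $D$ is a valuation overring $V$ of $D$ with $F^\star \subseteq FV$ for each $F \in \boldsymbol{f}(D)$; $(V,M)$ denotes $V$ with maximal ideal $M$. *)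

(* Defs.v *)
From HB Require Import structures.
From mathcomp Require Import all_boot all_order all_algebra.
From mathcomp Require Import boolp classical_sets.

Set Implicit Arguments.
Unset Strict Implicit.
Unset Printing Implicit Defensive.

Import GRing.Theory.
Local Open Scope classical_set_scope.
Local Open Scope ring_scope.

(* Subrings, ideals and submodules are Prop-valued subsets [set R] of an
   ambient commutative ring R; [A] below is the subring (possibly all of R)
   whose ideals are considered. *)
Section Ideals.
Variable R : comNzRingType.
Implicit Types A B I J P M : set R.

(* Finite sums of products a * b with a \in A and b \in B.  This is the usual
   product of submodules, and also the extension I A of an ideal I to a
   ring A. *)
Definition mulset A B : set R :=
  [set x | exists s : seq (R * R),
     (forall p, p \in s -> A p.1 /\ B p.2) /\ x = \sum_(p <- s) p.1 * p.2].

Definition ideal_of A I : Prop :=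
  [/\ I `<=` A, I 0, (forall x y, I x -> I y -> I (x + y))
    & (forall a x, A a -> I x -> I (a * x))].

Definition prime_ideal A P : Prop :=
  [/\ ideal_of A P, P <> A
    & forall x y, A x -> A y -> P (x * y) -> P x \/ P y].

Definition maximal_ideal A M : Prop :=
  [/\ ideal_of A M, M <> A
    & forall J, ideal_of A J -> J <> A -> M `<=` J -> J = M].

End Ideals.

Section FieldSubrings.
Variable F : fieldType.
Implicit Types A B V M m : set F.

(* V is a valuation overring of A, for a subring A of F whose quotient field
   is F: the ring V lies between A and F, and is a valuation ring of F. *)
Definition valuation_overring A V : Prop :=
  [/\ subring_closed (mem V), A `<=` V
    & forall x : F, x != 0 -> V x \/ V x^-1].

Definition dominates V M A m : Prop := A `<=` V /\ M `&` A = m.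

(* (A : B) *)
Definition residual A B : set F := [set z | forall b, B b -> A (z * b)].

End FieldSubrings.

Section Semistar.
Variable D : idomainType.
Local Notation K := {fraction D}.
Local Notation KX := {fraction {poly {fraction D}}}.

Definition toK (d : D) : K := FracField.tofrac d.

(* D[X] -> K[X] -> K(X) *)
Definition toKX (f : {poly D}) : KX :=
  FracField.tofrac (map_poly toK f).

Definition nz_submod (E : set K) : Prop :=
  [/\ E 0, (forall x y, E x -> E y -> E (x + y)),
      (forall (d : D) x, E x -> E (toK d * x))
    & exists2 x, E x & x != 0].

Definition span (s : seq K) : set K :=
  [set x | exists a : nat -> D, x = \sum_(i < size s) toK (a i) * s`_i].

Definition nz_fg_submod (E : set K) : Prop :=
  nz_submod E /\ exists s : seq K, E = span s.

(* A semistar operation is a total map on [set K] whose values matter only on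
   nonzero D-submodules of K. *)
Record semistar (star : set K -> set K) : Prop := {
  semistar_submod : forall E, nz_submod E -> nz_submod (star E);
  semistar_scale : forall (z : K) E, z != 0 -> nz_submod E ->
    star [set z * x | x in E] = [set z * x | x in star E];
  semistar_mono : forall E F, nz_submod E -> nz_submod F ->
    E `<=` F -> star E `<=` star F;
  semistar_ext : forall E, nz_submod E -> E `<=` star E;
  semistar_idem : forall E, nz_submod E -> star (star E) = star E
}.

Implicit Types (star : set K -> set K) (I P Q : set D).

Definition trivial_semistar star : Prop :=
  forall E, nz_submod E -> star E = setT.

Definition star_f star (E : set K) : set K :=
  \bigcup_(F in [set F | nz_fg_submod F /\ F `<=` E]) star F.

Definition finite_type star : Prop :=
  forall E, nz_submod E -> star E = star_f star E.

Definition star_a_fg star (F : set K) : set K :=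
  \bigcup_(H in [set H | nz_fg_submod H])
     residual (star (mulset F H)) (star H).

(* For finitely generated E this agrees with [star_a_fg star E], by
   monotonicity of the latter. *)
Definition star_a star (E : set K) : set K :=
  \bigcup_(F in [set F | nz_fg_submod F /\ F `<=` E]) star_a_fg star F.

Definition quasi_ideal star I : Prop :=
  [/\ ideal_of setT I, (exists2 d, I d & d != 0)
    & toK @^-1` star (toK @` I) = I].

Definition quasi_prime star P : Prop :=
  quasi_ideal star P /\ prime_ideal setT P.

Definition quasi_maximal star Q : Prop :=
  [/\ quasi_ideal star Q, Q <> setT
    & forall J, quasi_ideal star J -> J <> setT -> Q `<=` J -> J = Q].

Definition content (h : {poly D}) : set D :=
  [set d | exists a : nat -> D, d = \sum_(i < size h) a i * h`_i].

Definition contentK (h : {poly D}) : set K := toK @` content h.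

Definition Na star : set KX :=
  [set x | exists f g : {poly D},
     [/\ g != 0, star (contentK g) = star (range toK)
       & x = toKX f / toKX g]].

Definition Kr star : set KX :=
  [set x | exists f g : {poly D},
     [/\ f != 0, g != 0,
         (exists2 h : {poly D}, h != 0 &
            star (mulset (contentK f) (contentK h))
              `<=` star (mulset (contentK g) (contentK h)))
       & x = toKX f / toKX g]] `|` [set 0].

(* N `&` D[X] and N `&` D, as subsets of D[X] and D *)
Definition contrDX (N : set KX) : set {poly D} := toKX @^-1` N.
Definition contrD (N : set KX) : set D := [set d | N (toKX d%:P)].

(* I[X] *)
Definition poly_ext I : set {poly D} := [set f | forall i, I f`_i].

(* The extensions I A and J A of I `<=` D and J `<=` D[X] to a ring A
   between D[X] and K(X) *)
Definition extD I (A : set KX) : set KX :=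
  mulset [set toKX d%:P | d in I] A.
Definition extDX (J : set {poly D}) (A : set KX) : set KX :=
  mulset (toKX @` J) A.

Definition star_valuation_overring star (V : set K) : Prop :=
  valuation_overring (range toK) V /\
  forall F, nz_fg_submod F -> star F `<=` mulset F V.

(* D_Q and its maximal ideal Q D_Q, for Q prime *)
Definition loc Q : set K :=
  [set x | exists a s : D, ~ Q s /\ x = toK a / toK s].
Definition loc_max Q : set K := mulset (toK @` Q) (loc Q).

End Semistar.

(* Main.v *)
Require Import Defs.
From HB Require Import structures.
From mathcomp Require Import all_boot all_order all_algebra.
From mathcomp Require Import ring.
From mathcomp Require Import boolp classical_sets.

Set Implicit Arguments.
Unset Strict Implicit.
Unset Printing Implicit Defensive.

Import GRing.Theory.
Local Open Scope classical_set_scope.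
Local Open Scope ring_scope.

(** Write [c(f)] for the content of a polynomial [f] over [D].  Everything
rests on one preorder, [eab_le]: [E] lies below [F] when some nonzero finitely
generated [H] satisfies [E H] inside the [star]-closure of [F H].  For finitely
generated [E] and [F] this says that [E] lies in the e.a.b. closure of [F].  It
controls both objects of the theorem: [x] is in [star_a E] iff the singleton
[x] is below a finitely generated [F] inside [E] ([star_a_eab_le]), and [f / g]
is in [Kr(D, star)] iff [c(f)] is below [c(g)] ([KrP]).  The preorder is
compatible with products, and the Dedekind-Mertens lemma
[c(f)^(s+1) c(g) = c(f)^s c(fg)] (for [s >= size g]) makes it blind to the
difference between [c(f) c(g)] and [c(fg)].  Hence [Kr] is a ring, and the
denominators of [Na] are closed under products.

(1) All quotients [f_i / f] lie in [Kr], because [c(f_i)] lies in [c(f)].  So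
in a valuation overring [W] of [Kr] with maximal ideal [N], a polynomial is in
[N] exactly when all its coefficients are: this is [N_1 = N_0[X]], and the two
equalities about [Na] follow by writing [f / g] as a combination of the
[f_i].  If [d] is in the [star_a]-closure of [N_0], then [d] is below
[c(f)] for some [f] in [N_0[X]], so [d / f] is in [Kr], [f] is in [N], and
[d = (d / f) f] is in [N].

(2), (3) If [Q] is a proper quasi-[star_a]-ideal, the products [q k] with [q]
in [Q[X]] and [k] in [Kr] form an ideal of [Kr], as two of the [q] can be merged
into the single polynomial [q + X^n q'] that divides both in [Kr].  The ideal is
proper: [1 = q k] would give [1] below [c(q)], so [1] in [Q].  Take a maximal
ideal [M] of [Kr] above it.  By the same merging trick any two elements of [Kr]
generate a principal ideal, so the localization of [Kr] at [M] is a valuation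
ring, with the same contraction to [D].  By (1) that contraction is a proper
quasi-[star_a]-ideal containing [Q], hence is [Q] when [Q] is maximal.

(4) Intersect the valuation ring of (2) with [K].  If [c] is in [star c(f)]
then [c / f] is in [Kr].  Were every [c / f_i] outside the valuation ring, all
[f_i / c] would be in [N], so [f / c] would be too, and [1 = (c / f) (f / c)]
would be in [N]. *)

(** * Products and powers of ideals *)

Section ProductsOfSets.
Variable R : comNzRingType.
Implicit Types A B C I : set R.

Lemma mulset0 A B : mulset A B 0.
Proof. by exists [::]; rewrite big_nil; split. Qed.

Lemma mulset_mem A B a b : A a -> B b -> mulset A B (a * b).
Proof.
move=> Aa Bb; exists [:: (a, b)]; rewrite big_seq1; split=> // p.
by rewrite inE => /eqP ->.
Qed.

Lemma mulsetD A B x y : mulset A B x -> mulset A B y -> mulset A B (x + y).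
Proof.
move=> [s [sP ->]] [t [tP ->]]; exists (s ++ t); rewrite big_cat; split=> // p.
by rewrite mem_cat => /orP[/sP|/tP].
Qed.

Lemma mulset_ind A B C : C 0 -> (forall x y, C x -> C y -> C (x + y)) ->
  (forall a b, A a -> B b -> C (a * b)) -> forall x, mulset A B x -> C x.
Proof.
move=> C0 CD CM x [s [sP ->]]; elim: s sP => [|p s IH] sP.
  by rewrite big_nil.
rewrite big_cons; apply: CD.
  by have [] := sP p (mem_head _ _); apply: CM.
by apply: IH => q qs; apply: sP; rewrite inE qs orbT.
Qed.

Lemma mulset_sub A B C : C 0 -> (forall x y, C x -> C y -> C (x + y)) ->
  (forall a b, A a -> B b -> C (a * b)) -> mulset A B `<=` C.
Proof. exact: mulset_ind. Qed.

Lemma mulsetS A A' B B' :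
  A `<=` A' -> B `<=` B' -> mulset A B `<=` mulset A' B'.
Proof.
move=> AA BB; apply: mulset_sub; [exact: mulset0|exact: mulsetD|].
by move=> a b /AA ? /BB; apply: mulset_mem.
Qed.

Lemma mulsetC A B : mulset A B = mulset B A.
Proof.
have sub (X Y : set R) : mulset X Y `<=` mulset Y X.
  apply: mulset_sub; [exact: mulset0|exact: mulsetD|] => a b Xa Yb.
  by rewrite mulrC; apply: mulset_mem.
by apply/seteqP; split; apply: sub.
Qed.

Lemma mulsetA A B C : mulset A (mulset B C) = mulset (mulset A B) C.
Proof.
have sub (X Y Z : set R) : mulset X (mulset Y Z) `<=` mulset (mulset X Y) Z.
  apply: mulset_sub; [exact: mulset0|exact: mulsetD|] => a b Xa.
  move: b; apply: mulset_ind => [|x y|y z Yy Zz].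
  - by rewrite mulr0; apply: mulset0.
  - by rewrite mulrDr; apply: mulsetD.
  - by rewrite mulrA; do ![apply: mulset_mem].
apply/seteqP; split; first exact: sub.
have := @sub C B A.
by rewrite (mulsetC C (mulset B A)) (mulsetC B A) (mulsetC _ A) (mulsetC C B).
Qed.

Lemma mulset_ideal I : ideal_of setT I -> forall A, ideal_of setT (mulset A I).
Proof.
move=> [_ _ _ IM] A; split=> //; [exact: mulset0|exact: mulsetD|].
move=> a x _; move: x; apply: mulset_ind => [|x y|x y Ax Iy].
- by rewrite mulr0; apply: mulset0.
- by rewrite mulrDr; apply: mulsetD.
- by rewrite mulrCA; apply: mulset_mem => //; apply: IM.
Qed.

Lemma ideal_colon I c : ideal_of setT I -> ideal_of setT [set x | I (c * x)].
Proof.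
move=> [_ I0 ID IM]; split=> // [|x y Ix Iy|a x _ Ix] /=.
- by rewrite mulr0.
- by rewrite mulrDr; apply: ID.
- by rewrite mulrCA; apply: IM.
Qed.

Definition ideal_exp I k : set R := iter k (mulset I) setT.

Lemma ideal_exp_ideal I k : ideal_of setT (ideal_exp I k).
Proof.
by elim: k => [|k IH] //=; apply: mulset_ideal.
Qed.

Lemma ideal_expS I J k : I `<=` J -> ideal_exp I k `<=` ideal_exp J k.
Proof. by move=> IJ; elim: k => [|k IH] //=; apply: mulsetS. Qed.

(** Expanding the power of a sum: if [I = cR + J], every product of [k + 1]
elements of [I] either picks up a factor [c] or consists of elements of [J]
only.  This is what lets a leading coefficient be split off a content. *)
Lemma ideal_exp_add I J c k : ideal_of setT J -> J `<=` I ->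
  (forall x, I x -> exists2 d, J d & exists a, x = c * a + d) ->
  forall x, ideal_exp I k.+1 x ->
  exists u v, [/\ ideal_exp I k u, ideal_exp J k.+1 v & x = c * u + v].
Proof.
move=> Jid JI decI; elim: k => [|k IH].
  apply: mulset_ind => [|x y|a b Ia _].
  - by exists 0, 0; split=> //; [apply: mulset0|rewrite mulr0 addr0].
  - move=> [u [v [_ Jv ->]]] [u' [v' [_ Jv' ->]]].
    exists (u + u'), (v + v'); split=> //; first exact: mulsetD.
    by ring.
  - have [d Jd [a' ->]] := decI _ Ia.
    by exists (a' * b), (d * b); split=> //; [exact: mulset_mem|ring].
have [_ _ _ JMk] := ideal_exp_ideal J k.+1.
have [_ E0 ED _] := ideal_exp_ideal I k.+1.
have [_ F0 FD _] := ideal_exp_ideal J k.+2.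
apply: mulset_ind => [|x y|a b Ia].
- by exists 0, 0; split=> //; rewrite mulr0 addr0.
- move=> [u [v [Iu Jv ->]]] [u' [v' [Iu' Jv' ->]]].
  exists (u + u'), (v + v'); split; [exact: ED|exact: FD|].
  by ring.
- move=> /IH [u [v [Iu Jv ->]]].
  have [d Jd [a' E]] := decI _ Ia.
  exists (a * u + a' * v), (d * v); split; last by rewrite mulrDr {2}E; ring.
  + apply: ED; first exact: mulset_mem.
    by apply: (ideal_expS JI); apply: JMk.
  + exact: mulset_mem.
Qed.

End ProductsOfSets.

(** * Contents and the Dedekind-Mertens lemma *)

Section Content.
Variable D : idomainType.
Implicit Types (f g h : {poly D}) (I J : set D).

Lemma content_coef h i : content h h`_i.
Proof.
case: (ltnP i (size h)) => hi.
  exists (fun j => (j == i)%:R); rewrite (bigD1 (Ordinal hi)) //= eqxx mul1r.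
  rewrite big1 ?addr0 // => j ji.
  by have /negPf -> : (j != i :> nat) by []; rewrite mul0r.
exists (fun=> 0); rewrite nth_default // big1 // => j _.
by rewrite mul0r.
Qed.

Lemma content_ind h I : ideal_of setT I -> (forall i, I h`_i) ->
  forall d, content h d -> I d.
Proof.
move=> [_ I0 ID IM] Ih _ [a ->].
by elim/big_ind : _ => [|x y|i _]; [exact: I0|exact: ID|exact: IM].
Qed.

Lemma content_ideal h : ideal_of setT (content h).
Proof.
split=> // [|x y [a ->] [b ->]|a x _ [b ->]].
- by exists (fun=> 0); rewrite big1 // => j _; rewrite mul0r.
- exists (fun i => a i + b i); rewrite -big_split.
  by apply: eq_bigr => i _; rewrite mulrDl.
- exists (fun i => a * b i); rewrite mulr_sumr.
  by apply: eq_bigr => i _; rewrite mulrA.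
Qed.

Lemma content_sub h I : ideal_of setT I -> (forall i, I h`_i) ->
  content h `<=` I.
Proof. exact: content_ind. Qed.

Lemma contentM_sub f g : content (f * g) `<=` mulset (content f) (content g).
Proof.
have Iid := mulset_ideal (content_ideal g) (content f).
apply: content_ind => // i; have [_ I0 ID _] := Iid; rewrite coefM.
elim/big_ind : _ => [|x y|j _]; [exact: I0|exact: ID|].
by apply: mulset_mem; apply: content_coef.
Qed.

Lemma coef_truncate f n i :
  f`_i = f`_n * (i == n)%:R + (f - f`_n *: 'X^n)`_i.
Proof. by rewrite coefB coefZ coefXn; ring. Qed.

Lemma size_truncate f n : (size f <= n.+1)%N ->
  (size (f - f`_n *: 'X^n)%R <= n)%N.
Proof.
move=> fn; apply/leq_sizeP => j nj; rewrite coefB coefZ coefXn.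
case: eqP => [->|/eqP jn]; first by rewrite mulr1 subrr.
by rewrite mulr0 subr0 nth_default // (leq_trans fn) // ltn_neqAle eq_sym jn.
Qed.

Lemma coefM_top f g n m : (size f <= n.+1)%N -> (size g <= m.+1)%N ->
  (f * g)`_(n + m) = f`_n * g`_m.
Proof.
move=> fn gm; have ltn : (n < (n + m).+1)%N by rewrite ltnS leq_addr.
rewrite coefM (bigD1 (Ordinal ltn)) //= addKn big1 ?addr0 // => i.
rewrite -val_eqE /= neq_ltn => /orP[lt_in|lt_ni].
  rewrite [g`__]nth_default ?mulr0 // (leq_trans gm) // ltn_subRL.
  by rewrite ltn_add2r.
by rewrite nth_default ?mul0r // (leq_trans fn).
Qed.

(** Induction on the size of [g], then on the size of [f].  Let [a], [b] be the
leading coefficients of [f], [g] and [f'], [g'] the truncated polynomials.  As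
[f g' = f g - b X^s f] and [a b] is a coefficient of [f g], the first induction
hypothesis, multiplied by [a], puts [a c(f)^(s+1) c(g)] in the right-hand ideal.
As [f' g = f g - a X^n g], the second one then puts [c(f')^(s+2) c(g)] in it,
and these two kinds of products span the left-hand ideal. *)
Theorem dedekind_mertens s f g : (size g <= s)%N ->
  mulset (ideal_exp (content f) s.+1) (content g)
    `<=` mulset (ideal_exp (content f) s) (content (f * g)).
Proof.
elim: s f g => [|s IHs] f g gs.
  move: gs; rewrite leqn0 size_poly_eq0 => /eqP ->.
  apply: mulset_sub => [|x y|a b _]; [exact: mulset0|exact: mulsetD|].
  move=> [c ->]; rewrite size_poly0 big_ord0 !mulr0; exact: mulset0.
have [n fn] := ubnP (size f); elim: n f fn => [//|n IHn] f; rewrite ltnS => fn.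
case: n fn IHn => [|n] fn IHn.
  move: fn; rewrite leqn0 size_poly_eq0 => /eqP ->.
  apply: mulset_sub => [|x y|a b]; [exact: mulset0|exact: mulsetD|].
  move=> aP _.
  suff -> : a = 0 by rewrite [0 * b]mul0r; exact: mulset0.
  move: a aP; apply: mulset_ind => [//|x y -> ->|x y [c ->] _].
    by rewrite addr0.
  by rewrite size_poly0 big_ord0 mul0r.
set f' := f - f`_n *: 'X^n; set g' := g - g`_s *: 'X^s.
have f'n : (size f' < n.+1)%N by rewrite ltnS size_truncate.
have g's : (size g' <= s)%N by rewrite size_truncate.
set T := mulset (ideal_exp (content f) s.+1) (content (f * g)).
have Tid : ideal_of setT T by apply/mulset_ideal/content_ideal.
have [_ T0 TD TM] := Tid.
have TN x : T x -> T (- x) by rewrite -mulN1r; apply: TM.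
have [_ P0 PD PM] := ideal_exp_ideal (content f) s.+1.
have topP : content (f * g) (f`_n * g`_s).
  by rewrite -coefM_top //; apply: content_coef.
(* The products that contain the leading coefficient of f. *)
have key u b : ideal_exp (content f) s.+1 u -> content g b -> T (f`_n * u * b).
  move=> uP; move: b; apply: (content_sub (ideal_colon _ Tid)) => /=.
  have g'P c : content g' c -> T (f`_n * u * c).
    move=> cP; rewrite -mulrA.
    have : mulset (ideal_exp (content f) s) (content (f * g')) (u * c).
      by apply: IHs => //; apply: mulset_mem.
    move: (u * c); apply: mulset_ind => [|x y xP yP|p d pP].
    - by rewrite mulr0.
    - by rewrite mulrDr; apply: TD.
    rewrite mulrA; move: d; apply: (content_ind (ideal_colon _ Tid)) => k /=.
    have -> : f * g' = f * g - g`_s *: (f * 'X^s) by rewrite mulrBr scalerAr.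
    rewrite coefB coefZ coefMXn mulrBr.
    have pc i : ideal_exp (content f) s.+1 (f`_i * p).
      by apply: mulset_mem => //; apply: content_coef.
    apply: TD; first by apply: mulset_mem => //; apply: content_coef.
    apply: TN; case: ltnP => _; first by rewrite !mulr0.
    set fk := f`_(_ - _).
    have -> : f`_n * p * (g`_s * fk) = (fk * p) * (f`_n * g`_s) by ring.
    by apply: mulset_mem => //; apply: pc.
  move=> j; rewrite (coef_truncate g s j) mulrDr; apply: TD; last first.
    by apply: g'P; apply: content_coef.
  have -> : f`_n * u * (g`_s * (j == s)%:R) = (j == s)%:R * u * (f`_n * g`_s).
    by ring.
  by apply: mulset_mem => //; apply: PM.
have f'f : content f' `<=` content f.
  have [_ _ CD CM] := content_ideal f.
  apply: content_sub => [|i]; first exact: content_ideal.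
  rewrite /f' coefB coefZ mulrC -mulNr.
  by apply: CD; [|apply: CM => //]; apply: content_coef.
(* The products that avoid the leading coefficient of f. *)
have f'P v b : ideal_exp (content f') s.+2 v -> content g b -> T (v * b).
  move=> vP bP.
  have : mulset (ideal_exp (content f') s.+1) (content (f' * g)) (v * b).
    by apply: IHn => //; apply: mulset_mem.
  move: (v * b); apply: mulset_ind => // p d pP.
  have {}pP : ideal_exp (content f) s.+1 p by exact: ideal_expS pP.
  move: d; apply: (content_ind (ideal_colon _ Tid)) => k /=.
  have -> : f' * g = f * g - f`_n *: (g * 'X^n).
    by rewrite /f' mulrBl -scalerAl ['X^n * g]mulrC.
  rewrite coefB coefZ mulrBr.
  apply: TD; first by apply: mulset_mem => //; apply: content_coef.
  apply: TN; rewrite coefMXn; case: ltnP => _; first by rewrite !mulr0.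
  rewrite mulrA [p * _]mulrC; apply: key => //; exact: content_coef.
apply: mulset_sub => // w b wP bP.
have [||u [v [uP vP ->]]] := @ideal_exp_add _ (content f) (content f') f`_n
  s.+1 (content_ideal f') _ _ w wP.
- exact: f'f.
- apply: content_ind => [|i]; last first.
    exists f'`_i; first exact: content_coef.
    by exists (i == n)%:R; rewrite -coef_truncate.
  have [_ C0 CD CM] := content_ideal f'.
  split=> // [|x y|a x _].
  + by exists 0 => //; exists 0; rewrite mulr0 addr0.
  + move=> [d dP [c ->]] [d' dP' [c' ->]]; exists (d + d'); first exact: CD.
    by exists (c + c'); ring.
  + move=> [d dP [c ->]]; exists (a * d); first exact: CM.
    by exists (a * c); ring.
by rewrite mulrDl; apply: TD; [apply: key|apply: f'P].
Qed.

End Content.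

(** * Submodules of the quotient field *)

(* Declared under their own names so that the morphism rewriting rules apply to
   [toK] and [toKX] without unfolding them. *)
HB.instance Definition _ (D : idomainType) :=
  GRing.RMorphism.copy (@toK D) (@FracField.tofrac D).

HB.instance Definition _ (D : idomainType) :=
  GRing.RMorphism.copy (@toKX D)
    (@FracField.tofrac {poly {fraction D}} \o map_poly (@toK D)).

Section FractionField.
Variable D : idomainType.
Local Notation K := {fraction D}.
Local Notation toK := (@toK D).
Local Notation toKX := (@toKX D).
Local Notation span := (@Defs.span D).
Implicit Types (f g h : {poly D}) (E F G H : set K) (s t : seq K).

Lemma toK_inj : injective toK.
Proof. by move=> x y /eqP; rewrite tofrac_eq => /eqP. Qed.

Lemma toK_eq0 d : (toK d == 0) = (d == 0).
Proof. exact: tofrac_eq0. Qed.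

Lemma toKX_eq0 f : (toKX f == 0) = (f == 0).
Proof.
rewrite /toKX tofrac_eq0; apply/eqP/eqP => [|->]; last exact: map_poly0.
move/polyP => fP; apply/polyP => i; apply: toK_inj.
by have := fP i; rewrite coef_map !coef0 => ->; rewrite rmorph0.
Qed.

Lemma fraction_repr (R : idomainType) (x : {fraction R}) : exists a b,
  b != 0 /\ x = FracField.tofrac a / FracField.tofrac b.
Proof.
elim/quotW: x => r; exists (frac r).1, (frac r).2; split.
  exact: denom_ratioP.
have b0 : FracField.tofrac (frac r).2 != 0 :> {fraction R}.
  by rewrite tofrac_eq0 denom_ratioP.
apply: (mulIf b0); rewrite divfK //.
unlock FracField.tofrac; rewrite -[LHS]FracField.pi_mul.
apply/eqmodP; rewrite /= FracField.equivfE /FracField.mulf.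
by rewrite !numden_Ratio ?mulf_neq0 ?oner_eq0 ?denom_ratioP // !mulr1 mulrC.
Qed.

Lemma common_denominator s : exists (z : D) (t : seq D),
  z != 0 /\ map toK t = [seq toK z * x | x <- s].
Proof.
elim: s => [|x s [z [t [z0 tE]]]]; first by exists 1, [::]; rewrite oner_eq0.
have [a [b [b0 ->]]] := fraction_repr x.
exists (b * z), (z * a :: [seq b * y | y <- t]); split.
  by rewrite mulf_neq0.
rewrite /= !rmorphM; congr (_ :: _).
  rewrite -/(toK a) -/(toK b).
  by rewrite [toK b * _]mulrC -mulrA [toK a / _]mulrC mulVKf ?toK_eq0.
rewrite -map_comp (eq_map (g := ( *%R (toK b)) \o toK)); last first.
  by move=> y /=; rewrite rmorphM.
by rewrite map_comp tE -map_comp; apply: eq_map => y /=; rewrite mulrA.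
Qed.

Lemma nz_mulset E F : nz_submod E -> nz_submod F -> nz_submod (mulset E F).
Proof.
move=> [_ _ EM [x Ex x0]] [_ _ _ [y Fy y0]]; split.
- exact: mulset0.
- exact: mulsetD.
- move=> d x'; move: x'; apply: mulset_ind => [|z z'|z z' Ez Fz].
  + by rewrite mulr0; exact: mulset0.
  + by rewrite mulrDr; exact: mulsetD.
  + by rewrite mulrA; apply: mulset_mem => //; apply: EM.
- by exists (x * y); [apply: mulset_mem|rewrite mulf_neq0].
Qed.

Lemma span_mem s x : x \in s -> span s x.
Proof.
move=> xs; exists (fun j => (j == index x s)%:R).
have hi : (index x s < size s)%N by rewrite index_mem.
rewrite (bigD1 (Ordinal hi)) //= eqxx rmorph1 mul1r nth_index //.
rewrite big1 ?addr0 // => j ji.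
by have /negPf -> : (j != index x s :> nat) by []; rewrite rmorph0 mul0r.
Qed.

Lemma span_ind s E : E 0 -> (forall x y, E x -> E y -> E (x + y)) ->
  (forall (d : D) x, E x -> E (toK d * x)) -> (forall x, x \in s -> E x) ->
  forall x, span s x -> E x.
Proof.
move=> E0 ED EM Es _ [a ->].
elim/big_ind : _ => [|x y|i _]; [exact: E0|exact: ED|apply: EM].
by apply: Es; apply: mem_nth.
Qed.

Lemma span_closed s :
  [/\ span s 0, forall x y, span s x -> span s y -> span s (x + y)
    & forall (d : D) x, span s x -> span s (toK d * x)].
Proof.
split=> [|u v [a ->] [b ->]|d _ [b ->]].
- by exists (fun=> 0); rewrite big1 // => j _; rewrite rmorph0 mul0r.
- exists (fun i => a i + b i); rewrite -big_split.
  by apply: eq_bigr => i _; rewrite rmorphD mulrDl.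
- exists (fun i => d * b i); rewrite mulr_sumr.
  by apply: eq_bigr => i _; rewrite rmorphM mulrA.
Qed.

Lemma nz_span s x : x \in s -> x != 0 -> nz_submod (span s).
Proof.
have [S0 SD SM] := span_closed s.
by move=> xs x0; split=> //; exists x => //; apply: span_mem.
Qed.

Lemma nz_fg_span s x : x \in s -> x != 0 -> nz_fg_submod (span s).
Proof. by move=> xs x0; split; [exact: nz_span xs x0|exists s]. Qed.

Lemma span_sub s E : nz_submod E -> (forall x, x \in s -> E x) -> span s `<=` E.
Proof. by move=> [E0 ED EM _] Es; apply: span_ind. Qed.

Lemma range_toK : range toK = span [:: 1].
Proof.
apply/seteqP; split=> [_ [d _ <-]|_ [a ->]].
  by exists (fun=> d); rewrite big_ord1 mulr1.
by rewrite big_ord1 mulr1; exists (a 0%N).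
Qed.

Lemma nz_fg_range : nz_fg_submod (range toK).
Proof.
by rewrite range_toK; apply: (@nz_fg_span _ 1); rewrite ?inE ?oner_eq0.
Qed.

Lemma nz_fg_mulset E F :
  nz_fg_submod E -> nz_fg_submod F -> nz_fg_submod (mulset E F).
Proof.
move=> [nzE [s Es]] [nzF [t Ft]]; have nzEF := nz_mulset nzE nzF.
split=> //; set p := [seq x * y | x <- s, y <- t]; exists p.
have spanp : forall x y, x \in s -> y \in t -> span p (x * y).
  by move=> x y xs yt; apply: span_mem; apply: allpairs_f.
have [S0 SD SM] := span_closed p.
apply/seteqP; split.
  rewrite Es Ft; apply: mulset_sub => // x y xs; move: y; apply: span_ind.
  - by rewrite mulr0.
  - by move=> y z ? ?; rewrite mulrDr; apply: SD.
  - by move=> d y ?; rewrite mulrCA; apply: SM.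
  move=> y yt; move: x xs; apply: span_ind.
  - by rewrite mul0r.
  - by move=> x z ? ?; rewrite mulrDl; apply: SD.
  - by move=> d x ?; rewrite -mulrA; apply: SM.
  - by move=> x xs; apply: spanp.
apply: span_sub => // _ /allpairsP[[x y] [/= xs yt ->]].
by apply: mulset_mem; rewrite ?Es ?Ft; apply: span_mem.
Qed.

Lemma nz_scale z E : z != 0 -> nz_submod E -> nz_submod [set z * x | x in E].
Proof.
move=> z0 [E0 ED EM [x Ex x0]]; split.
- by exists 0; rewrite ?mulr0.
- move=> _ _ [u Eu <-] [v Ev <-].
  by exists (u + v); rewrite ?mulrDr; [exact: ED|].
- by move=> d _ [u Eu <-]; exists (toK d * u); [exact: EM|rewrite mulrCA].
- by exists (z * x); [exists x|rewrite mulf_neq0].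
Qed.

Lemma nz_toK_ideal I d : ideal_of setT I -> I d -> d != 0 ->
  nz_submod (toK @` I).
Proof.
move=> [_ I0 ID IM] Id d0; split.
- by exists 0; rewrite ?rmorph0.
- move=> _ _ [x Ix <-] [y Iy <-].
  by exists (x + y); rewrite ?rmorphD; [exact: ID|].
- by move=> a _ [x Ix <-]; exists (a * x); rewrite ?rmorphM; [exact: IM|].
- by exists (toK d); [exists d|rewrite toK_eq0].
Qed.

Lemma toK_mulset (I J : set D) :
  toK @` mulset I J = mulset (toK @` I) (toK @` J).
Proof.
apply/seteqP; split=> [_ [x + <-]|].
  move: x; apply: mulset_ind => [|x y|x y Ix Jy].
  - by rewrite rmorph0; exact: mulset0.
  - by rewrite rmorphD; exact: mulsetD.
  - by rewrite rmorphM; apply: mulset_mem; [exists x|exists y].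
apply: mulset_sub => [|_ _ [x IJx <-] [y IJy <-]|_ _ [x Ix <-] [y Jy <-]].
- by exists 0; rewrite ?rmorph0 //; exact: mulset0.
- by exists (x + y); rewrite ?rmorphD //; exact: mulsetD.
- by exists (x * y); rewrite ?rmorphM //; exact: mulset_mem.
Qed.

Lemma contentK_coef f i : contentK f (toK f`_i).
Proof. by exists f`_i => //; apply: content_coef. Qed.

Lemma contentK_sub f E : nz_submod E -> (forall i, E (toK f`_i)) ->
  contentK f `<=` E.
Proof.
move=> [E0 ED EM _] Ef _ [d + <-]; move: d; apply: content_ind => //.
split=> // [x y Ex Ey|a x _ Ex].
  by rewrite rmorphD; apply: ED.
by rewrite rmorphM; apply: EM.
Qed.

Lemma contentK_range f : contentK f `<=` range toK.
Proof. by move=> _ [d _ <-]; exists d. Qed.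

Lemma poly_neq0_coef f : f != 0 -> exists i, f`_i != 0.
Proof.
by move=> f0; exists (size f).-1; rewrite -lead_coefE lead_coef_eq0.
Qed.

Lemma nz_contentK f : f != 0 -> nz_submod (contentK f).
Proof.
move=> /poly_neq0_coef[i fi].
exact: (nz_toK_ideal (content_ideal f) (content_coef f i)).
Qed.

Lemma contentK_span s f : map toK f = s -> contentK f = span s.
Proof.
move=> <-; apply/seteqP; split=> [_ [_ [a ->] <-]|_ [a ->]].
  exists a; rewrite size_map rmorph_sum; apply: eq_bigr => i _.
  by rewrite rmorphM (nth_map 0).
exists (\sum_(i < size f) a i * f`_i); first by exists a.
rewrite rmorph_sum size_map; apply: eq_bigr => i _.
by rewrite rmorphM (nth_map 0).
Qed.

Lemma nz_fg_contentK f : f != 0 -> nz_fg_submod (contentK f).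
Proof.
by move=> f0; split; [exact: nz_contentK|eexists; apply: contentK_span].
Qed.

Lemma contentK_const (d : D) f :
  contentK (d%:P * f) = [set toK d * x | x in contentK f].
Proof.
have [_ C0 CD CM] := content_ideal (d%:P * f).
apply/seteqP; split=> [_ [x + <-]|_ [_ [x + <-] <-]]; move: x.
  apply: content_ind => [|i]; last first.
    by rewrite coefCM rmorphM; exists (toK f`_i) => //; exact: contentK_coef.
  have [_ F0 FD FM] := content_ideal f.
  split=> // [|x y|a x _].
  - by exists 0; rewrite ?mulr0 ?rmorph0 //; exists 0; rewrite ?rmorph0.
  - move=> [_ [u Fu <-] uE] [_ [v Fv <-] vE]; exists (toK (u + v)).
      by exists (u + v) => //; exact: FD.
    by rewrite !rmorphD mulrDr uE vE.
  - move=> [_ [u Fu <-] uE]; exists (toK (a * u)).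
      by exists (a * u) => //; exact: FM.
    by rewrite !rmorphM mulrCA uE.
apply: content_ind => [|i]; last first.
  by rewrite -rmorphM -coefCM; exact: contentK_coef.
split=> // [|x y|a x _].
- by rewrite rmorph0 mulr0; exists 0; rewrite ?rmorph0.
- move=> [u Fu uE] [v Fv vE]; exists (u + v); first exact: CD.
  by rewrite !rmorphD /= uE vE mulrDr.
- move=> [u Fu uE]; exists (a * u); first exact: CM.
  by rewrite !rmorphM /= uE mulrCA.
Qed.

(** Contents provide all finitely generated submodules inside [D]: use a list of
generators as the list of coefficients. *)
Lemma nz_fg_contentK_eq H : nz_fg_submod H -> H `<=` range toK ->
  exists2 h, h != 0 & H = contentK h.
Proof.
move=> [nzH [s Hs]] Hr.
have [t tE] : exists t : seq D, map toK t = s.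
  have : forall x, x \in s -> exists d, toK d = x.
    move=> x xs; have [|d _ <-] := Hr x; last by exists d.
    by rewrite Hs; apply: span_mem.
  elim: s {Hs} => [|x s IH] sr; first by exists [::].
  have [t tE] : exists t : seq D, map toK t = s.
    by apply: IH => y ys; apply: sr; rewrite inE ys orbT.
  by have [|d dE] := sr x; [rewrite mem_head|exists (d :: t); rewrite /= dE tE].
have HE : H = contentK (Poly t).
  apply/seteqP; split.
    have tmem x : x \in s -> contentK (Poly t) x.
      rewrite -tE => /mapP[d /(nthP 0)[i _ <-] ->].
      by rewrite -coef_Poly; apply: contentK_coef.
    rewrite Hs.
    have [_ F0 FD FM] := content_ideal (Poly t).
    apply: span_ind => [||d _ [v Fv <-]|//].
    - by exists 0; rewrite ?rmorph0.
    - move=> _ _ [u Fu <-] [v Fv <-].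
      by exists (u + v); rewrite ?rmorphD //; exact: FD.
    - by exists (d * v); rewrite ?rmorphM //; exact: FM.
  apply: contentK_sub => // i; rewrite coef_Poly.
  have [it|it] := ltnP i (size t); last first.
    by rewrite nth_default // rmorph0; case: nzH.
  rewrite Hs; apply: span_mem; rewrite -tE -(nth_map 0 0) //.
  by rewrite mem_nth // size_map.
exists (Poly t) => //; apply/eqP => t0.
have [_ _ _ [x + /eqP]] := nzH; rewrite HE t0 => -[_ [a ->] <-].
by rewrite size_poly0 big_ord0 rmorph0.
Qed.

(** Up to a nonzero factor in [D], which closures respect, a finitely generated
submodule can thus be taken to be a content, as in the definition of [Kr]. *)
Lemma nz_fg_scaled_contentK H : nz_fg_submod H ->
  exists d h, [/\ d != 0, h != 0 & [set toK d * x | x in H] = contentK h].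
Proof.
move=> [nzH [s Hs]]; have [d [t [d0 tE]]] := common_denominator s.
have dK : toK d != 0 by rewrite toK_eq0.
have HE : [set toK d * x | x in H] = span (map toK t).
  rewrite tE Hs; apply/seteqP; split=> [_ [_ [a ->] <-]|_ [a ->]].
    exists a; rewrite size_map mulr_sumr; apply: eq_bigr => i _.
    by rewrite (nth_map 0) // mulrCA.
  exists (\sum_(i < size s) toK (a i) * s`_i); first by exists a.
  rewrite size_map mulr_sumr; apply: eq_bigr => i _.
  by rewrite (nth_map 0) // mulrCA.
have [||h h0 hE] := @nz_fg_contentK_eq [set toK d * x | x in H].
- by split; [exact: nz_scale|exists (map toK t)].
- have [[r0 rD rM _] _] := nz_fg_range.
  rewrite HE; apply: span_ind => // _ /mapP[a _ ->]; by exists a.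
by exists d, h.
Qed.

Lemma contentK_mul_sub f g :
  contentK (f * g) `<=` mulset (contentK f) (contentK g).
Proof.
by rewrite /contentK -toK_mulset => _ [x /contentM_sub xP <-]; exists x.
Qed.

(** Denominators are cleared for the coefficients of numerator and denominator
at once, so that the common factor cancels. *)
Lemma KX_repr x : exists f g, g != 0 /\ x = toKX f / toKX g.
Proof.
have [p [q [q0 ->]]] := fraction_repr x.
have [d [t [d0 tE]]] := common_denominator (p ++ q).
have part r (u := [seq toK d * x | x <- r] : seq K) (w : seq D) :
    map toK w = u -> map_poly toK (Poly w) = toK d *: (Poly r).
  move=> wE; apply/polyP => i; rewrite coef_map coefZ !coef_Poly.
  have sz : size w = size r by rewrite -(size_map toK) wE size_map.
  have [iw|iw] := ltnP i (size w).
    by rewrite -(nth_map 0 0) // wE (nth_map 0) -?sz.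
  by rewrite !nth_default ?sz ?rmorph0 ?mulr0 // -sz.
exists (Poly (take (size p) t)), (Poly (drop (size p) t)).
have {}pE : map_poly toK (Poly (take (size p) t)) = toK d *: p.
  by rewrite -[in RHS](polyseqK p); apply: part; rewrite map_take tE map_cat
    take_size_cat ?size_map.
have {}qE : map_poly toK (Poly (drop (size p) t)) = toK d *: q.
  by rewrite -[in RHS](polyseqK q); apply: part; rewrite map_drop tE map_cat
    drop_size_cat ?size_map.
have dK : toK d != 0 by rewrite toK_eq0.
split.
  by rewrite -toKX_eq0 /Defs.toKX qE tofrac_eq0 scaler_eq0 negb_or dK.
rewrite /Defs.toKX pE qE -!mul_polyC !rmorphM /=.
by rewrite -mulf_div divff ?mul1r // tofrac_eq0 polyC_eq0.
Qed.

End FractionField.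

(** * The preorder attached to a semistar operation *)

Section StarCalculus.
Variables (D : idomainType) (star : set {fraction D} -> set {fraction D}).
Hypothesis starP : semistar star.
Local Notation K := {fraction D}.
Local Notation toK := (@toK D).
Implicit Types E F G H : set K.

Lemma star_closure E F : nz_submod E -> nz_submod F ->
  E `<=` star F -> star E `<=` star F.
Proof.
move=> nzE nzF EF; rewrite -(semistar_idem starP nzF).
by apply: (semistar_mono starP) => //; apply: (semistar_submod starP).
Qed.

(** Multiplication by a fixed nonzero [y] commutes with the closure, and [y E]
lies in [E F]. *)
Lemma star_mulr E F x y : nz_submod E -> nz_submod F ->
  star E x -> F y -> star (mulset E F) (x * y).
Proof.
move=> nzE nzF Ex Fy; have nzEF := nz_mulset nzE nzF.
have [S0 _ _ _] := semistar_submod starP nzEF.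
have [->|y0] := eqVneq y 0; first by rewrite mulr0.
have : [set y * u | u in star E] (x * y) by exists x => //; rewrite mulrC.
rewrite -(semistar_scale starP) //; apply: (semistar_mono starP) => //.
  exact: nz_scale.
by move=> _ [u Eu <-]; rewrite mulrC; apply: mulset_mem.
Qed.

Lemma star_mul E F x y : nz_submod E -> nz_submod F ->
  star E x -> star F y -> star (mulset E F) (x * y).
Proof.
move=> nzE nzF Ex Fy; have nzEF := nz_mulset nzE nzF.
have nzsE := semistar_submod starP nzE.
have nzsF := semistar_submod starP nzF.
apply: (star_closure (nz_mulset nzE nzsF)) => //; last first.
  exact: star_mulr.
have [S0 SD _ _] := semistar_submod starP nzEF.
apply: mulset_sub => // a b Ea Fb; rewrite mulsetC mulrC.
exact: star_mulr.
Qed.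

(** Stated on products [e * h] instead of the submodule [E H], so that it makes
sense when [E] is a mere set, such as a singleton or a zero content. *)
Definition eab_le_at H E F := forall e h, E e -> H h ->
  star (mulset F H) (e * h).

(** For finitely generated [E] and [F], this is the inclusion of [E] in
[star_a F]. *)
Definition eab_le E F := exists2 H, nz_fg_submod H & eab_le_at H E F.

(** A witness can be enlarged by a factor, so finitely many relations always
share a witness, namely the product of the separate ones. *)
Lemma eab_le_atr H H' E F : nz_submod F -> nz_submod H -> nz_submod H' ->
  eab_le_at H E F -> eab_le_at (mulset H H') E F.
Proof.
move=> nzF nzH nzH' EF e h Ee; rewrite mulsetA.
have [S0 SD _ _] := semistar_submod starP
  (nz_mulset (nz_mulset nzF nzH) nzH').
move: h; apply: mulset_ind => [|x y|x y Hx Hy].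
- by rewrite mulr0.
- by rewrite mulrDr; apply: SD.
- by rewrite mulrA; apply: star_mulr; [apply: nz_mulset| |apply: EF|].
Qed.

Lemma eab_le_atl H H' E F : nz_submod F -> nz_submod H -> nz_submod H' ->
  eab_le_at H' E F -> eab_le_at (mulset H H') E F.
Proof. by rewrite mulsetC => *; apply: eab_le_atr. Qed.

Lemma eab_le_star E F : nz_submod F -> E `<=` star F -> eab_le E F.
Proof.
move=> nzF EF; exists (range toK); first exact: nz_fg_range.
by have [nzK _] := nz_fg_range D; move=> e h /EF Fe Kh; apply: star_mulr.
Qed.

Lemma eab_le_subset E F : nz_submod F -> E `<=` F -> eab_le E F.
Proof.
by move=> nzF EF; apply: eab_le_star => // e /EF; apply: (semistar_ext starP).
Qed.

Lemma eab_le_subl E E' F : E `<=` E' -> eab_le E' F -> eab_le E F.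
Proof. by move=> EE' [H nzH EF]; exists H => // e h /EE'; apply: EF. Qed.

Lemma eab_le_trans E F G : nz_submod F -> nz_submod G ->
  eab_le E F -> eab_le F G -> eab_le E G.
Proof.
move=> nzF nzG [H fgH EF] [H' fgH' FG].
have [nzH _] := fgH; have [nzH' _] := fgH'.
exists (mulset H H'); first exact: nz_fg_mulset.
have {}EF := eab_le_atr nzF nzH nzH' EF.
have {}FG := eab_le_atl nzG nzH nzH' FG.
have nzHH := nz_mulset nzH nzH'; have nzGH := nz_mulset nzG nzHH.
have [S0 SD _ _] := semistar_submod starP nzGH.
move=> e h Ee Hh; apply: (star_closure (nz_mulset nzF nzHH)) => //; last first.
  exact: EF.
exact: mulset_sub.
Qed.

Lemma eab_le_mul E E' F F' : nz_submod F -> nz_submod F' ->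
  eab_le E F -> eab_le E' F' -> eab_le (mulset E E') (mulset F F').
Proof.
move=> nzF nzF' [H fgH EF] [H' fgH' EF'].
have [nzH _] := fgH; have [nzH' _] := fgH'.
have nzM := nz_mulset (nz_mulset nzF nzF') (nz_mulset nzH nzH').
have [S0 SD _ _] := semistar_submod starP nzM.
exists (mulset H H'); first exact: nz_fg_mulset.
move=> e h + Hh; move: e; apply: mulset_ind => [|x y|x y Ex Ey].
- by rewrite mul0r.
- by rewrite mulrDl; apply: SD.
move: h Hh; apply: mulset_ind => [|u v|u v Hu Hv].
- by rewrite mulr0.
- by rewrite mulrDr; apply: SD.
rewrite mulrACA mulsetA -(mulsetA F) (mulsetC F') mulsetA -mulsetA.
by apply: star_mul; [exact: nz_mulset|exact: nz_mulset|exact: EF|exact: EF'].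
Qed.

(** The cancellation property that gives e.a.b. operations their name: the
cancelled factor is absorbed by the witness. *)
Lemma eab_le_cancel E F G : nz_submod F -> nz_fg_submod G ->
  eab_le (mulset E G) (mulset F G) -> eab_le E F.
Proof.
move=> nzF fgG [H fgH EF]; have [nzH _] := fgH; have [nzG _] := fgG.
exists (mulset G H); first exact: nz_fg_mulset.
have nzM := nz_mulset nzF (nz_mulset nzG nzH).
have [S0 SD _ _] := semistar_submod starP nzM.
move=> e h Ee; move: h; apply: mulset_ind => [|x y|x y Gx Hy].
- by rewrite mulr0.
- by rewrite mulrDr; apply: SD.
- by rewrite mulrA mulsetA; apply: EF => //; apply: mulset_mem.
Qed.

Lemma eab_le_add E1 E2 E F : nz_submod F -> eab_le E1 F -> eab_le E2 F ->
  (forall e, E e -> exists2 e1, E1 e1 & exists2 e2, E2 e2 & e = e1 + e2) ->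
  eab_le E F.
Proof.
move=> nzF [H fgH EF] [H' fgH' EF'] decE.
have [nzH _] := fgH; have [nzH' _] := fgH'.
have nzM := nz_mulset nzF (nz_mulset nzH nzH').
have [S0 SD _ _] := semistar_submod starP nzM.
exists (mulset H H'); first exact: nz_fg_mulset.
move=> e h /decE[e1 Ee1 [e2 Ee2 ->]] Hh; rewrite mulrDl; apply: SD.
  exact: (eab_le_atr nzF nzH nzH' EF).
exact: (eab_le_atl nzF nzH nzH' EF').
Qed.

(** The definition of [star_a] multiplies [x] with the closure of the witness;
by scaling, multiplying it with the witness itself is enough. *)
Lemma star_a_eab_le E x :
  star_a star E x <->
  exists F, [/\ nz_fg_submod F, F `<=` E & eab_le [set x] F].
Proof.
split=> [[F [fgF FE] [H fgH xFH]]|[F [fgF FE [H fgH xFH]]]].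
  have [nzH _] := fgH.
  exists F; split=> //; exists H => // _ h -> Hh; apply: xFH.
  exact: (semistar_ext starP).
exists F => //; exists H => // b.
have [nzH _] := fgH; have [nzF _] := fgF; have nzFH := nz_mulset nzF nzH.
have [S0 _ _ _] := semistar_submod starP nzFH.
have [->|x0] := eqVneq x 0; first by rewrite mul0r.
move=> Hb; have : [set x * y | y in star H] (x * b) by exists b.
rewrite -(semistar_scale starP) //; apply: star_closure => //.
  exact: nz_scale.
by move=> _ [y Hy <-]; apply: xFH.
Qed.

Lemma sub_star_a E : nz_submod E -> E `<=` star_a star E.
Proof.
move=> nzE x Ex; apply/star_a_eab_le; have [_ _ _ [y Ey y0]] := nzE.
exists (@Defs.span D [:: x; y]).
have fg : nz_fg_submod (@Defs.span D [:: x; y]).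
  by apply: (nz_fg_span _ y0); rewrite !inE eqxx orbT.
split=> //.
  by apply: span_sub => // z; rewrite !inE => /orP[] /eqP ->.
case: fg => nzF _; apply: eab_le_subset => // _ ->.
by apply: span_mem; rewrite inE eqxx.
Qed.

Lemma star_a_mono E F : E `<=` F -> star_a star E `<=` star_a star F.
Proof.
by move=> EF x [G [fgG GE] xG]; exists G => //; split=> // y /GE /EF.
Qed.

Lemma star_sub_star_a E : finite_type star -> nz_submod E ->
  star E `<=` star_a star E.
Proof.
move=> ft nzE x; rewrite ft // => -[F [fgF FE] Fx].
apply/star_a_eab_le; exists F; split=> //.
by have [nzF _] := fgF; apply: eab_le_star => // _ ->.
Qed.

End StarCalculus.

(** * Maximal ideals, valuation rings and localization *)

(** The usual form of Zorn's lemma: since a starting set [I] is given, only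
nonempty chains have to be bounded. *)
Lemma zorn_above (T : Type) (C : set (set T)) (I : set T) : C I ->
  (forall S : set (set T), S !=set0 -> S `<=` C -> total_on S subset ->
     C (\bigcup_(X in S) X)) ->
  exists M, [/\ C M, I `<=` M & forall J, C J -> M `<=` J -> J = M].
Proof.
move=> CI chain.
have [S SC St|A [CA Amax]] := @Zorn_bigcup T [set X | C (X `|` I)].
  have [S0|/set0P[X0 SX0]] := eqVneq S set0.
    by rewrite /= S0 bigcup_set0 set0U.
  rewrite /=; have -> : \bigcup_(X in S) X `|` I
      = \bigcup_(Y in [set X `|` I | X in S]) Y.
    apply/seteqP; split=> [x [[X SX Xx]|Ix]|x [_ [X SX <-] [Xx|Ix]]].
    - by exists (X `|` I); [exists X|left].
    - by exists (X0 `|` I); [exists X0|right].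
    - by left; exists X.
    - by right.
  apply: chain => [|_ [X /SC CX <-] //|_ _ [X SX <-] [Y SY <-]].
    by exists (X0 `|` I); exists X0.
  by have [XY|YX] := St _ _ SX SY; [left|right]; apply: setSU.
exists (A `|` I); split=> // J CJ MJ; apply: contrapT => JM.
apply: (Amax J); last by rewrite /= setUidl // => x Ix; apply: MJ; right.
split=> [x Ax|JA]; first by apply: MJ; left.
by apply: JM; apply/seteqP; split=> // x /JA; left.
Qed.

Lemma ideal_one (R : comNzRingType) (A I : set R) :
  ideal_of A I -> I 1 -> I = A.
Proof.
move=> [IA _ _ IM] I1; apply/seteqP; split=> // x Ax.
by rewrite -[x]mulr1; apply: IM.
Qed.

Lemma chain_ideal (R : comNzRingType) (A : set R) (S : set (set R)) :
  S !=set0 -> (forall I, S I -> ideal_of A I) -> total_on S subset ->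
  ideal_of A (\bigcup_(I in S) I).
Proof.
move=> [I0 SI0] Sid St.
split=> [x [I SI Ix]||x y [I SI Ix] [J SJ Jy]|a x Aa [I SI Ix]].
- by have [IA _ _ _] := Sid I SI; apply: IA.
- by exists I0 => //; have [] := Sid I0 SI0.
- have [IJ|JI] := St I J SI SJ.
    by exists J => //; have [_ _ JD _] := Sid J SJ; apply: JD => //; apply: IJ.
  by exists I => //; have [_ _ ID _] := Sid I SI; apply: ID => //; apply: JI.
- by exists I => //; have [_ _ _ IM] := Sid I SI; apply: IM.
Qed.

Section Subrings.
Variable F : fieldType.
Implicit Types A I M W N : set F.

Lemma subringP A : subring_closed (mem A) <->
  [/\ A 1, forall x y, A x -> A y -> A (x - y)
    & forall x y, A x -> A y -> A (x * y)].
Proof.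
have inA x : (x \in mem A) = (x \in A) by [].
split=> -[A1 AB AM]; split.
- by move: A1; rewrite inA inE.
- by move=> x y Ax Ay; have := AB x y; rewrite !inA !inE; apply.
- by move=> x y Ax Ay; have := AM x y; rewrite !inA !inE; apply.
- by rewrite inA inE.
- by move=> x y; rewrite !inA !inE; apply: AB.
- by move=> x y; rewrite !inA !inE; apply: AM.
Qed.

Lemma subring_ops A : subring_closed (mem A) ->
  [/\ A 0, A 1, forall x, A x -> A (- x),
      forall x y, A x -> A y -> A (x + y)
    & forall x y, A x -> A y -> A (x * y)].
Proof.
move=> /subringP[A1 AB AM].
have A0 : A 0 by rewrite -(subrr 1); apply: AB.
have AN x : A x -> A (- x) by move=> ?; rewrite -sub0r; apply: AB.
split=> // x y Ax Ay; rewrite -[y]opprK; apply: AB => //; exact: AN.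
Qed.

Lemma maximal_one A M : subring_closed (mem A) -> maximal_ideal A M -> ~ M 1.
Proof. by move=> _ [Mid MA _] /(ideal_one Mid). Qed.

Lemma maximal_comaximal A M x : subring_closed (mem A) -> maximal_ideal A M ->
  A x -> ~ M x -> exists m k, [/\ M m, A k & 1 = m + x * k].
Proof.
move=> /subring_ops[A0 A1 AN AD AM] [[MA M0 MD MM] _ Mmax] Ax nMx.
pose J := [set y | exists m k, [/\ M m, A k & y = m + x * k]].
have MJ : M `<=` J by move=> m Mm; exists m, 0; rewrite mulr0 addr0.
have Jx : J x by exists 0, 1; rewrite mulr1 add0r.
have idJ : ideal_of A J.
  split; [|exact: MJ| |].
    by move=> _ [m [k [/MA Am Ak ->]]]; apply: AD => //; exact: AM.
    move=> _ _ [m [k [Mm Ak ->]]] [m' [k' [Mm' Ak' ->]]].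
    exists (m + m'), (k + k'); split; [exact: MD|exact: AD|ring].
  move=> a _ Aa [m [k [Mm Ak ->]]].
  exists (a * m), (a * k); split; [exact: MM|exact: AM|ring].
have [JA|/eqP JA] := eqVneq J A.
  by have : J 1; [rewrite JA|move=> [m [k H]]; exists m, k].
by case: nMx; rewrite -(Mmax J).
Qed.

Lemma maximal_prime A M x y : subring_closed (mem A) -> maximal_ideal A M ->
  A x -> A y -> M (x * y) -> M x \/ M y.
Proof.
move=> Asub Mmax Ax Ay Mxy; have [[_ _ MD MM] _ _] := Mmax.
have [|nMx] := pselect (M x); first by left.
have [m [k [Mm Ak E]]] := maximal_comaximal Asub Mmax Ax nMx.
right; rewrite -[y]mulr1 E mulrDr; apply: MD; first exact: MM.
by rewrite (_ : y * (x * k) = k * (x * y)); [exact: MM|ring].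
Qed.

Lemma local_maximal A M : subring_closed (mem A) -> ideal_of A M -> ~ M 1 ->
  (forall x, A x -> ~ M x -> A x^-1) -> maximal_ideal A M.
Proof.
move=> /subring_ops[A0 A1 _ _ _] idM M1 inv; split=> //.
  by move=> E; apply: M1; rewrite E.
move=> J idJ JA MJ; apply/seteqP; split=> // x Jx.
apply: contrapT => nMx; apply: JA; apply: (ideal_one idJ).
have [JsA _ _ JM] := idJ; have x0 : x != 0.
  by apply/eqP => x0; apply: nMx; rewrite x0; case: idM.
by rewrite -(mulVf x0); apply: JM => //; apply: inv => //; exact: JsA.
Qed.

Section Valuation.
Variables (A W N : set F).
Hypotheses (valW : valuation_overring A W) (maxN : maximal_ideal W N).

(** In [1 = m + x k], dividing by [x] shows that [1 / x] is in [W] as soon as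
[m / x] is; otherwise [x / m] is in [W] and [x] would be in [N]. *)
Lemma valuation_inv x : W x -> ~ N x -> W x^-1.
Proof.
have [Wsub _ tot] := valW; have [W0 W1 WN WD WM] := subring_ops Wsub.
have [[NW N0 ND NM] _ _] := maxN.
move=> Wx nNx; have [m [k [Nm Wk E]]] := maximal_comaximal Wsub maxN Wx nNx.
have x0 : x != 0 by apply/eqP => x0; apply: nNx; rewrite x0.
have -> : x^-1 = m / x + k.
  by apply: (mulfI x0); rewrite mulfV // E; field.
apply: WD => //; have [->|m0] := eqVneq m 0; first by rewrite mul0r.
have [|//|W'] := tot (m / x); first by rewrite mulf_neq0 ?invr_eq0.
by case: nNx; rewrite -[x](divfK m0) -[x / m]invrK invf_div; apply: NM.
Qed.

Lemma valuation_maximal x : x != 0 -> ~ W x -> N x^-1.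
Proof.
have [_ _ tot] := valW => x0 nWx; have [//|Wx] := tot x x0.
by apply: contrapT => /(valuation_inv Wx); rewrite invrK.
Qed.

End Valuation.

(** The relation [a + k b = 1] prevents both [a] and [b] from lying in [M], so
that one of [a / b] and [b / a] is in the localization. *)
Lemma localization_valuation A M :
  subring_closed (mem A) -> maximal_ideal A M ->
  (forall x, x != 0 -> exists a b k,
     [/\ A a, A b, A k, x = a / b & a + k * b = 1]) ->
  exists W N,
    [/\ valuation_overring A W, maximal_ideal W N & N `&` A = M].
Proof.
move=> AS maxM bezout; have [A0 A1 AN AD AM] := subring_ops AS.
have [[MA M0 MD MM] _ _] := maxM.
have M1 := maximal_one AS maxM.
have Mprime x y := maximal_prime (x := x) (y := y) AS maxM.
have MS s t : A s -> A t -> ~ M s -> ~ M t -> ~ M (s * t).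
  by move=> As At Ms Mt /(Mprime _ _ As At)[].
have nM0 s : ~ M s -> s != 0.
  by move=> Ms; apply/eqP => s0; apply: Ms; rewrite s0.
pose L I := [set x | exists a s, [/\ I a, A s, ~ M s & x = a / s]].
have L_sub I : I `<=` L I.
  by move=> a Ia; exists a, 1; rewrite divr1.
have LD I : (forall a b, I a -> I b -> I (a + b)) ->
    (forall k a, A k -> I a -> I (k * a)) ->
    forall x y, L I x -> L I y -> L I (x + y).
  move=> ID IM _ _ [a [s [Ia As Ms ->]]] [b [t [Ib At Mt ->]]].
  exists (t * a + s * b), (s * t); split; [|exact: AM|exact: MS|].
    by apply: ID; apply: IM.
  by rewrite addf_div ?nM0 // (mulrC t) (mulrC s b).
have LM I : (forall k a, A k -> I a -> I (k * a)) ->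
    forall x y, L A x -> L I y -> L I (x * y).
  move=> IM _ _ [a [s [Aa As Ms ->]]] [b [t [Ib At Mt ->]]].
  by exists (a * b), (s * t); rewrite mulf_div; split;
    [exact: IM|exact: AM|exact: MS|].
have LS : subring_closed (mem (L A)).
  apply/subringP; split; [exact: L_sub| |exact: LM].
  move=> x y Lx Ly; apply: LD => //; rewrite -mulN1r; apply: LM => //.
  by apply/L_sub/AN.
have L_M x : L M x -> A x -> M x.
  move=> [a [s [Ma As Ms xE]]] Ax.
  have : M (x * s) by rewrite xE divfK ?nM0.
  by move=> /(Mprime _ _ Ax As)[].
(* W is the ring of fractions with denominator outside M, and N its part with
   numerator in M. *)
exists (L A), (L M); split.
- split; [exact: LS|exact: L_sub|move=> x /bezout[a [b [k [Aa Ab Ak -> E]]]]].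
  have [Mb|nMb] := pselect (M b); last by left; exists a, b.
  right; exists b, a; rewrite invf_div; split=> // Ma; apply: M1.
  by rewrite -E; apply: MD => //; apply: MM.
- apply: local_maximal; first exact: LS.
  + split; [|exact: L_sub|exact: LD|exact: LM].
    by move=> _ [a [s [/MA Aa As Ms ->]]]; exists a, s.
  + by move=> /L_M /(_ A1).
  + move=> _ [a [s [Aa As Ms ->]]] nL.
    exists s, a; rewrite invf_div; split=> // Ma; apply: nL.
    by exists a, s.
- apply/seteqP; split=> [x [/L_M]|x Mx]; first by apply.
  by split; [exact: L_sub|exact: MA].
Qed.

End Subrings.

(** * The Kronecker function ring *)

Definition KtoKX (D : idomainType) (x : {fraction D}) :
  {fraction {poly {fraction D}}} := FracField.tofrac x%:P.

HB.instance Definition _ (D : idomainType) :=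
  GRing.RMorphism.copy (@KtoKX D)
    (@FracField.tofrac {poly {fraction D}} \o polyC).

Section KroneckerFunctionRing.
Variables (D : idomainType) (star : set {fraction D} -> set {fraction D}).
Hypothesis starP : semistar star.
Local Notation K := {fraction D}.
Local Notation KX := {fraction {poly {fraction D}}}.
Local Notation toK := (@toK D).
Local Notation toKX := (@toKX D).
Local Notation eab_le := (eab_le star).
Local Notation Kr := (Kr star).
Implicit Types (f g h e : {poly D}) (x y : KX).

Lemma KtoKX_toK d : KtoKX (toK d) = toKX d%:P.
Proof. by rewrite /KtoKX /Defs.toKX map_polyC. Qed.

Lemma range_sub (E : set K) : nz_submod E -> E 1 -> range toK `<=` E.
Proof.
by move=> [_ _ EM _] E1 _ [d _ <-]; rewrite -[toK d]mulr1; apply: EM.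
Qed.

Lemma contentK1 : contentK (1 : {poly D}) = range toK.
Proof.
apply/seteqP; split; first exact: contentK_range.
apply: range_sub; first exact/nz_contentK/oner_neq0.
by have := contentK_coef (1 : {poly D}) 0; rewrite coef1 rmorph1.
Qed.

Lemma nz_fg_ideal_exp f s : f != 0 ->
  nz_fg_submod (toK @` ideal_exp (content f) s).
Proof.
move=> f0; elim: s => [|s IH]; first exact: nz_fg_range.
by rewrite /= toK_mulset; apply: nz_fg_mulset => //; apply: nz_fg_contentK.
Qed.

Lemma dedekind_mertensK f g s : (size g <= s)%N ->
  mulset (toK @` ideal_exp (content f) s.+1) (contentK g)
    `<=` mulset (toK @` ideal_exp (content f) s) (contentK (f * g)).
Proof.
move=> gs; rewrite -!toK_mulset => _ [x xP <-].
by exists x => //; apply: dedekind_mertens xP.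
Qed.

(** The inclusion of [c(fg)] in [c(f) c(g)] becomes an equivalence for the
preorder: by the Dedekind-Mertens lemma, a power of [c(f)] is a witness. *)
Lemma eab_le_contentM f g : f != 0 -> g != 0 ->
  eab_le (mulset (contentK f) (contentK g)) (contentK (f * g)).
Proof.
move=> f0 g0; have fgH := nz_fg_ideal_exp (size g) f0; have [nzH _] := fgH.
have nzfg : nz_submod (contentK (f * g)).
  by apply: nz_contentK; rewrite mulf_neq0.
exists (toK @` ideal_exp (content f) (size g)) => // e h efg Hh.
apply: (semistar_ext starP); first exact: nz_mulset.
rewrite mulsetC; apply: (dedekind_mertensK (leqnn _)).
rewrite /= toK_mulset -/(contentK f) -(mulsetA (contentK f)).
rewrite [X in mulset _ X]mulsetC mulsetA; exact: mulset_mem.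
Qed.

Lemma eab_le_content_mul f g f' g' : g != 0 -> g' != 0 ->
  eab_le (contentK f) (contentK g) -> eab_le (contentK f') (contentK g') ->
  eab_le (contentK (f * f')) (contentK (g * g')).
Proof.
move=> g0 g'0 fg fg'; have nzg := nz_contentK g0; have nzg' := nz_contentK g'0.
apply: (eab_le_trans starP (nz_mulset nzg nzg')); last exact: eab_le_contentM.
  by apply: nz_contentK; rewrite mulf_neq0.
apply: (eab_le_subl (@contentK_mul_sub D f f')); exact: eab_le_mul.
Qed.

(** The definition of [Kr] only allows contents of polynomials as witnesses;
scaling turns an arbitrary witness into such a content. *)
Lemma KrP x : Kr x <-> exists f g,
  [/\ g != 0, eab_le (contentK f) (contentK g) & x = toKX f / toKX g].
Proof.
split.
  move=> [[f [g [f0 g0 [h h0 sub] ->]]]|->]; last first.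
    exists 0, 1; rewrite oner_neq0 rmorph0 mul0r; split=> //.
    have nz1 : nz_submod (contentK (1 : {poly D})).
      exact/nz_contentK/oner_neq0.
    apply: eab_le_subset => //; apply: contentK_sub => // i.
    by rewrite coef0 rmorph0; case: nz1.
  exists f, g; split=> //; exists (contentK h); first exact: nz_fg_contentK.
  move=> a b fa hb; apply: sub; apply: (semistar_ext starP).
    by apply: nz_mulset; exact: nz_contentK.
  exact: mulset_mem.
move=> [f [g [g0 [H fgH fg] ->]]].
have [->|f0] := eqVneq f 0; first by right; rewrite rmorph0 mul0r.
left; exists f, g; split=> //.
have [d [h [d0 h0 Hh]]] := nz_fg_scaled_contentK fgH; exists h => //.
have [nzH _] := fgH; have nzf := nz_contentK f0; have nzg := nz_contentK g0.
have nzh := nz_contentK h0; have nzgh := nz_mulset nzg nzh.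
apply: (star_closure starP) => //; first exact: nz_mulset.
have [S0 SD _ _] := semistar_submod starP nzgh.
apply: mulset_sub => // a b fa; rewrite -Hh => -[b' Hb' <-].
have dK : toK d != 0 by rewrite toK_eq0.
have nzgH := nz_mulset nzg nzH.
have : [set toK d * u | u in star (mulset (contentK g) H)] (a * (toK d * b')).
  by exists (a * b'); [exact: fg|rewrite mulrCA].
rewrite -(semistar_scale starP) // Hh; apply: (semistar_mono starP) => //.
  exact: nz_scale.
move=> _ [u + <-]; move: u; have [M0 MD _ _] := nzgh.
apply: mulset_ind => [|u v ? ?|u v gu Hv].
- by rewrite mulr0.
- by rewrite mulrDr; apply: MD.
- by rewrite mulrCA; apply: mulset_mem => //; rewrite -Hh; exists v.
Qed.

Lemma Kr_frac f g : g != 0 -> eab_le (contentK f) (contentK g) ->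
  Kr (toKX f / toKX g).
Proof. by move=> g0 fg; apply/KrP; exists f, g. Qed.

Lemma Kr_coefs f g : g != 0 -> (forall i, content g f`_i) ->
  Kr (toKX f / toKX g).
Proof.
move=> g0 fg; have nzg := nz_contentK g0; apply: Kr_frac => //.
by apply: eab_le_subset => //; apply: contentK_sub => // i; exists f`_i.
Qed.

Lemma Kr_toKX f : Kr (toKX f).
Proof.
rewrite -[toKX f]divr1 -(rmorph1 toKX); apply: Kr_frac; first exact: oner_neq0.
apply: (eab_le_subset starP); first exact/nz_contentK/oner_neq0.
by rewrite contentK1; apply: contentK_range.
Qed.

Lemma Kr_coef f i : f != 0 -> Kr (toKX (f`_i)%:P / toKX f).
Proof.
move=> f0; apply: Kr_coefs => // j; rewrite coefC; case: eqP => _.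
  exact: content_coef.
by have [] := content_ideal f.
Qed.

Lemma Kr_inv g : g != 0 -> eab_le [set 1] (contentK g) -> Kr (toKX g)^-1.
Proof.
move=> g0 [H fgH gH]; rewrite -[_^-1]mul1r -(rmorph1 toKX).
apply: Kr_frac => //; rewrite contentK1; exists H => // _ h [d _ <-] Hh.
have [nzH _] := fgH; have nzg := nz_contentK g0.
have [_ _ SM _] := semistar_submod starP (nz_mulset nzg nzH).
by apply: SM; rewrite -[h]mul1r; apply: gH.
Qed.

Lemma Kr_subring : subring_closed (mem Kr).
Proof.
have KrD x y : Kr x -> Kr y -> Kr (x + y).
  move=> /KrP[f [g [g0 fg ->]]] /KrP[f' [g' [g'0 fg' ->]]].
  rewrite addf_div ?toKX_eq0 // -!rmorphM -rmorphD; apply: Kr_frac.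
    by rewrite mulf_neq0.
  have nz p : p != 0 -> nz_submod (contentK p) by exact: nz_contentK.
  have refl p : p != 0 -> eab_le (contentK p) (contentK p).
    by move=> p0; apply: eab_le_subset => //; exact: nz.
  apply: (eab_le_add starP (E1 := contentK (f * g')) (E2 := contentK (f' * g))).
  - by apply: nz; rewrite mulf_neq0.
  - by apply: eab_le_content_mul => //; apply: refl.
  - by rewrite (mulrC g); apply: eab_le_content_mul => //; apply: refl.
  move=> _ [d + <-]; move: d; apply: content_ind => [|i]; last first.
    exists (toK (f * g')`_i); first exact: contentK_coef.
    exists (toK (f' * g)`_i); first exact: contentK_coef.
    by rewrite coefD rmorphD.
  have [_ P0 PD PM] := content_ideal (f * g').
  have [_ Q0 QD QM] := content_ideal (f' * g).
  split=> // [|a b|c a _].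
  - exists 0; first by exists 0; rewrite ?rmorph0.
    by exists 0; rewrite ?rmorph0 ?addr0 //; exists 0; rewrite ?rmorph0.
  - move=> [_ [u Pu <-] [_ [v Qv <-] /= uv]].
    move=> [_ [u' Pu' <-] [_ [v' Qv' <-] /= uv']].
    exists (toK (u + u')); first by exists (u + u') => //; exact: PD.
    exists (toK (v + v')); first by exists (v + v') => //; exact: QD.
    by rewrite !rmorphD /= uv uv' addrACA.
  - move=> [_ [u Pu <-] [_ [v Qv <-] /= uv]].
    exists (toK (c * u)); first by exists (c * u) => //; exact: PM.
    exists (toK (c * v)); first by exists (c * v) => //; exact: QM.
    by rewrite !rmorphM /= uv mulrDr.
have KrM x y : Kr x -> Kr y -> Kr (x * y).
  move=> /KrP[f [g [g0 fg ->]]] /KrP[f' [g' [g'0 fg' ->]]].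
  rewrite mulf_div -!rmorphM; apply: Kr_frac; first by rewrite mulf_neq0.
  exact: eab_le_content_mul.
have Kr1 : Kr 1 by rewrite -(rmorph1 toKX); apply: Kr_toKX.
have KrN1 : Kr (-1) by rewrite -(rmorph1 toKX) -rmorphN; apply: Kr_toKX.
apply/subringP; split=> // x y Kx Ky.
by apply: KrD => //; rewrite -mulN1r; apply: KrM.
Qed.

(** With [n = size f], the coefficients of [f + X^n g] are those of [f] followed
by those of [g], so its content is the sum of the two contents. *)
Lemma poly_merge f g : exists e,
  [/\ forall i, content e f`_i, forall i, content e g`_i,
      exists n, e = f + 'X^n * g
    & forall I : set D, I 0 -> (forall i, I f`_i) -> (forall i, I g`_i) ->
        forall i, I e`_i].
Proof.
pose n := size f; exists (f + 'X^n * g).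
have coef_e i : (f + 'X^n * g)`_i = if (i < n)%N then f`_i else g`_(i - n).
  rewrite coefD coefXnM; case: ltnP => ni; first by rewrite addr0.
  by rewrite nth_default ?add0r.
have [_ C0 _ _] := content_ideal (f + 'X^n * g).
split=> [i|i||I I0 If Ig i]; last by rewrite coef_e; case: ifP.
- case: (ltnP i n) => ni; last by rewrite nth_default.
  by have := content_coef (f + 'X^n * g) i; rewrite coef_e ni.
- have := content_coef (f + 'X^n * g) (n + i).
  by rewrite coef_e ltnNge leq_addr addKn.
- by exists n.
Qed.

Lemma content_neq0 f e : f != 0 -> (forall i, content e f`_i) -> e != 0.
Proof.
move=> /poly_neq0_coef[i fi] fe; apply/eqP => e0; move/eqP: fi; apply.
by have [a ->] := fe i; rewrite e0 size_poly0 big_ord0.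
Qed.

End KroneckerFunctionRing.

(** * Contracting valuation overrings of the Kronecker function ring *)

Section Contractions.
Variables (D : idomainType) (star : set {fraction D} -> set {fraction D}).
Hypothesis starP : semistar star.
Local Notation K := {fraction D}.
Local Notation KX := {fraction {poly {fraction D}}}.
Local Notation toK := (@toK D).
Local Notation toKX := (@toKX D).
Local Notation eab_le := (eab_le star).
Local Notation Kr := (Kr star).
Implicit Types (f g h e : {poly D}) (x y : KX).

Lemma toKX_expand f : toKX f = \sum_(i < size f) toKX (f`_i)%:P * toKX 'X^i.
Proof.
rewrite -{1}[f]coefK poly_def rmorph_sum; apply: eq_bigr => i _.
by rewrite -mul_polyC rmorphM.
Qed.

Section Valuation.
Variables W N : set KX.
Hypotheses (valW : valuation_overring Kr W) (maxN : maximal_ideal W N).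

Lemma valuation_toKX f : W (toKX f).
Proof. by have [_ sub _] := valW; apply/sub/Kr_toKX. Qed.

(** [f_i = (f_i / f) f], where [f_i / f] is in [Kr]. *)
Lemma maximal_coef f i : N (toKX f) -> N (toKX (f`_i)%:P).
Proof.
have [[_ N0 _ NM] _ _] := maxN; have [_ sub _] := valW.
have [->|f0] := eqVneq f 0; first by rewrite coef0.
move=> Nf; rewrite -[toKX _%:P](divfK (x := toKX f)) ?toKX_eq0 //.
by apply: NM => //; apply/sub/Kr_coef.
Qed.

Lemma maximal_toKXP f : N (toKX f) <-> poly_ext (contrD N) f.
Proof.
have [[_ N0 ND NM] _ _] := maxN.
split=> [Nf i|fN]; first exact: maximal_coef.
rewrite toKX_expand; elim/big_ind : _ => // i _.
by rewrite mulrC; apply: NM; [exact: valuation_toKX|exact: fN].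
Qed.

Lemma contrDX_poly_ext : contrDX N = poly_ext (contrD N).
Proof. by apply/seteqP; split=> f /maximal_toKXP. Qed.

(** The set [U] of denominators abstracts the condition [c(g)^* = D^*], so that
the lemma covers [Na] for both [star] and [star_a]. *)
Lemma contr_Na (U : {poly D} -> Prop) :
  U 1 -> (forall f g, f != 0 -> g != 0 -> U f -> U g -> U (f * g)) ->
  (forall g, g != 0 -> U g -> Kr (toKX g)^-1) ->
  let A := [set x | exists f g, [/\ g != 0, U g & x = toKX f / toKX g]] in
  N `&` A = extD (contrD N) A /\ extD (contrD N) A = extDX (contrDX N) A.
Proof.
move=> U1 UM UK A; have [[_ N0 ND NM] _ _] := maxN.
have [Wsub sub _] := valW; have [_ _ _ _ WM] := subring_ops Wsub.
have s1 : N `&` A `<=` extD (contrD N) A.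
  move=> z [+ [f [g [g0 Ug zE]]]]; rewrite {z}zE => Nfg.
  have Nf : N (toKX f).
    rewrite -(divfK (x := toKX g) _ (toKX f)) ?toKX_eq0 //.
    by rewrite mulrC; apply: NM => //; exact: valuation_toKX.
  rewrite toKX_expand mulr_suml; elim/big_ind : _ => [|x y|i _].
  - exact: mulset0.
  - exact: mulsetD.
  - rewrite -mulrA; apply: mulset_mem; last by exists 'X^i, g.
    by exists f`_i => //; exact: maximal_coef.
have s2 : extD (contrD N) A `<=` extDX (contrDX N) A.
  by apply: mulsetS => // _ [d Nd <-]; exists d%:P.
have s3 : extDX (contrDX N) A `<=` N `&` A.
  apply: mulset_sub => [|x y [Nx Ax] [Ny Ay]|_ _ [f Nf <-] [f' [g [g0 Ug ->]]]].
  - split=> //; exists 0, 1; rewrite oner_neq0 rmorph0 mul0r; by split.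
  - split; first exact: ND.
    move: Ax Ay => [f [g [g0 Ug ->]]] [f' [g' [g'0 Ug' ->]]].
    exists (f * g' + f' * g), (g * g').
    split; [by rewrite mulf_neq0|exact: UM|].
    by rewrite addf_div ?toKX_eq0 // rmorphD !rmorphM.
  - split; last by exists (f * f'), g; rewrite rmorphM mulrA.
    rewrite mulrC; apply: NM => //; apply: WM; first exact: valuation_toKX.
    exact/sub/UK.
by split; apply/seteqP; split=> x xP;
  [exact: s1|apply/s3/s2|exact: s2|apply/s1/s3].
Qed.

Lemma contrD_prime : prime_ideal setT (contrD N).
Proof.
have [Wsub sub _] := valW; have [[_ N0 ND NM] _ _] := maxN.
split.
- split=> // [|a b Na Nb|a b _ Nb]; rewrite /contrD /=.
  + by rewrite polyC0 rmorph0.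
  + by rewrite polyCD rmorphD; apply: ND.
  + by rewrite polyCM rmorphM; apply: NM => //; exact: valuation_toKX.
- move=> E; apply: (maximal_one Wsub maxN).
  by have : contrD N 1; [rewrite E|rewrite /contrD /= polyC1 rmorph1].
- move=> a b _ _; rewrite /contrD /= polyCM rmorphM.
  by apply: (maximal_prime Wsub) => //; exact: valuation_toKX.
Qed.

(** The inverse of an element outside [W] is in [N], and so is its numerator. *)
Lemma contrD_neq0 : W <> setT -> exists2 d, contrD N d & d != 0.
Proof.
move=> WT; have [x nWx] : exists x, ~ W x.
  apply: contrapT => nex; apply: WT; apply/seteqP; split=> // x _.
  by apply: contrapT => nWx; apply: nex; exists x.
have [Wsub _ _] := valW; have [W0 _ _ _ _] := subring_ops Wsub.
have x0 : x != 0 by apply/eqP => x0; apply: nWx; rewrite x0.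
have Nx := valuation_maximal valW maxN x0 nWx.
have [f [g [g0 xE]]] := KX_repr x^-1.
have f0 : f != 0.
  apply/eqP => f0; move: xE; rewrite f0 rmorph0 mul0r => /eqP.
  by rewrite invr_eq0 (negPf x0).
have Nf : N (toKX f).
  have -> : toKX f = toKX g * x^-1 by rewrite xE mulrC divfK ?toKX_eq0.
  by have [[_ _ _ NM] _ _] := maxN; apply: NM => //; exact: valuation_toKX.
have [i fi] := poly_neq0_coef f0; exists f`_i => //; exact: maximal_coef.
Qed.

(** If [d] is below [c(f)] with [f] in [N_0[X]], then [d / f] is in [Kr], so [d]
is a multiple of [f] in [W]. *)
Lemma star_a_contrD d : star_a star (toK @` contrD N) (toK d) -> contrD N d.
Proof.
have [_ sub _] := valW; have [[_ N0 ND NM] _ _] := maxN.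
move=> /star_a_eab_le - /(_ starP)[F [fgF FN dF]].
have [f f0 Ff] : exists2 f, f != 0 & F = contentK f.
  by apply: nz_fg_contentK_eq => // _ /FN[c _ <-]; exists c.
have Nf : N (toKX f).
  apply/maximal_toKXP => i; have /FN[c Nc /toK_inj <- //] : F (toK f`_i).
  by rewrite Ff; exact: contentK_coef.
have Kf : Kr (toKX d%:P / toKX f).
  apply: Kr_frac => //; rewrite -Ff; move: dF => [H fgH dF]; exists H => //.
  have [nzH _] := fgH; have [nzF _] := fgF.
  have [S0 SD SM _] := semistar_submod starP (nz_mulset nzF nzH).
  move=> _ h [c + <-] Hh; move: c; apply: content_ind => [|i].
    split=> // [|a b aP bP|a b _ bP]; first by rewrite rmorph0 mul0r.
      by rewrite rmorphD mulrDl; apply: SD.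
    by rewrite rmorphM -mulrA; apply: SM.
  rewrite coefC; case: eqP => _; first exact: dF.
  by rewrite rmorph0 mul0r.
rewrite /contrD /= -[toKX _](divfK (x := toKX f)) ?toKX_eq0 //.
by apply: NM => //; exact: sub.
Qed.

Lemma contrD_quasi_prime : W <> setT -> quasi_prime (star_a star) (contrD N).
Proof.
move=> WT; have Pprime := contrD_prime; have [Pid _ _] := Pprime.
have [d Nd d0] := contrD_neq0 WT.
do !split=> //; first by exists d.
apply/seteqP; split=> c; first exact: star_a_contrD.
move=> Nc; apply: (sub_star_a starP); last by exists c.
exact: nz_toK_ideal Pid Nd d0.
Qed.

End Valuation.

Lemma quasi_prime_star_a P : finite_type star ->
  quasi_prime (star_a star) P -> quasi_prime star P.
Proof.
move=> ft [[Pid [d Pd d0] PE] Pprime].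
split=> //; split=> //; first by exists d.
have nzP := nz_toK_ideal Pid Pd d0.
apply/seteqP; split=> c.
  by move=> cP; rewrite -PE; apply: star_sub_star_a.
by move=> Pc; apply: (semistar_ext starP) => //; exists c.
Qed.

(** The ideal generated by [Q] in [Kr] is described as the set [J] of products
[q k] with [q] in [Q[X]]: merging two such [q] shows that it is closed under
sums, and a product representation of [1] can be read as a content relation. *)
Lemma Kr_center Q : quasi_ideal (star_a star) Q -> Q <> setT ->
  exists2 M, maximal_ideal Kr M & Q `<=` contrD M.
Proof.
move=> [Qid [d0 Qd0 d00] QE] QT; have [_ Q0 QD QM] := Qid.
have KrS := Kr_subring starP; have [K0 K1 KN KD KM] := subring_ops KrS.
pose J := [set x | exists q k, [/\ poly_ext Q q, Kr k & x = toKX q * k]].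
have idJ : ideal_of Kr J.
  split.
  - by move=> _ [q [k [_ Kk ->]]]; apply: KM => //; exact: Kr_toKX.
  - by exists 0, 0; split; [move=> i; rewrite coef0|exact: K0|rewrite mulr0].
  - move=> _ _ [q [k [Qq Kk ->]]] [q' [k' [Qq' Kk' ->]]].
    have [e [eq eq' _ /(_ Q Q0 Qq Qq') Qe]] := poly_merge q q'.
    have [e0|e0] := eqVneq e 0.
      have z (p : {poly D}) : (forall i, content e p`_i) -> p = 0.
        move=> pe; apply: contrapT => /eqP/content_neq0/(_ pe).
        by rewrite e0 eqxx.
      exists 0, 0; split; [by move=> i; rewrite coef0|exact: K0|].
      by rewrite (z q) // (z q') // [toKX 0]rmorph0 !mul0r addr0.
    exists e, (toKX q / toKX e * k + toKX q' / toKX e * k'); split=> //.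
      by apply: KD; apply: KM => //; apply: Kr_coefs.
    rewrite mulrDr; congr (_ + _); rewrite mulrA; congr (_ * _);
      by rewrite mulrC divfK ?toKX_eq0.
  - move=> a _ Ka [q [k [Qq Kk ->]]]; exists q, (a * k).
    by split=> //; [exact: KM|rewrite mulrCA].
(* From 1 = q f / g we get g = f q, so c(f) is below c(g), hence below
   c(f) c(q); cancelling c(f) leaves 1 below c(q). *)
have J1 : ~ J 1.
  move=> [q [k [Qq /KrP - /(_ starP)[f [g [g0 fg ->]]]]]] E.
  have q0 : q != 0.
    apply/eqP => q0; move/eqP: E; by rewrite q0 rmorph0 mul0r oner_eq0.
  have f0 : f != 0.
    apply/eqP => f0; move/eqP: E; by rewrite f0 rmorph0 mul0r mulr0 oner_eq0.
  have gE : g = f * q.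
    apply/eqP; rewrite -subr_eq0 -toKX_eq0 rmorphB rmorphM /= subr_eq0.
    by rewrite -[toKX g]mul1r E mulrA divfK ?toKX_eq0 // mulrC.
  apply: QT; apply: (ideal_one Qid).
  rewrite -QE /= rmorph1; apply/(star_a_eab_le starP).
  exists (contentK q); split.
  - exact: nz_fg_contentK.
  - by move=> _ [d dq <-]; exists d => //; apply: (content_sub Qid Qq).
  have nzq := nz_contentK q0; have nzf := nz_contentK f0.
  apply: (eab_le_cancel starP nzq (nz_fg_contentK f0)).
  apply: (@eab_le_subl _ _ _ (contentK f)).
    have [F0 FD _ _] := nzf; apply: mulset_sub => // _ b -> fb.
    by rewrite mul1r.
  have nzg := nz_contentK g0; have nzqf := nz_mulset nzq nzf.
  apply: (eab_le_trans starP nzg nzqf) => //.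
  apply: (eab_le_subset starP) => //.
  by rewrite gE (mulrC f); apply: contentK_mul_sub.
have [|M [[idM M1] JM Mmax]] := @zorn_above _
  [set M | ideal_of Kr M /\ ~ M 1] J (conj idJ J1).
  move=> S S0 SP St; split; last by move=> [I /SP[]].
  by apply: chain_ideal => // I /SP[].
exists M.
  split=> //; first by move=> E; apply: M1; rewrite E.
  move=> J' idJ' J'K MJ'; apply: Mmax => //; split=> // /(ideal_one idJ').
  exact: J'K.
move=> d Qd; apply: JM; exists d%:P, 1; rewrite mulr1; split=> // i.
by rewrite coefC; case: eqP.
Qed.

End Contractions.

(** * Centers on quasi-maximal ideals *)

Section Centers.
Variables (D : idomainType) (star : set {fraction D} -> set {fraction D}).
Hypothesis starP : semistar star.
Local Notation K := {fraction D}.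
Local Notation KX := {fraction {poly {fraction D}}}.
Local Notation toK := (@toK D).
Local Notation toKX := (@toKX D).
Local Notation eab_le := (eab_le star).
Local Notation Kr := (Kr star).
Implicit Types f g : {poly D}.

(** For [x = f / g], the merged polynomial [e = f + X^n g] divides both [f] and
[g] in [Kr], and [f / e + X^n (g / e) = 1]. *)
Lemma Kr_bezout_ratio (x : KX) : x != 0 -> exists a b k,
  [/\ Kr a, Kr b, Kr k, x = a / b & a + k * b = 1].
Proof.
move=> x0; have [f [g [g0 xE]]] := KX_repr x.
have f0 : f != 0.
  by apply/eqP => f0; move/eqP: x0; apply; rewrite xE f0 [toKX 0]rmorph0 mul0r.
have [e [fe ge [n eE] _]] := poly_merge f g; have e0 := content_neq0 f0 fe.
exists (toKX f / toKX e), (toKX g / toKX e), (toKX 'X^n).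
split; [exact: Kr_coefs|exact: Kr_coefs|exact: Kr_toKX| |].
  by rewrite invf_div mulrA divfK ?toKX_eq0.
by rewrite mulrA -mulrDl -rmorphM -rmorphD -eE divff ?toKX_eq0.
Qed.

Lemma Kr_valuation_center Q : finite_type star ->
  quasi_maximal (star_a star) Q -> exists M W N,
  [/\ maximal_ideal Kr M, contrD M = Q, valuation_overring Kr W,
      maximal_ideal W N & contrD N = Q].
Proof.
move=> ft [Qq QT Qmax]; have [M maxM QM] := Kr_center starP Qq QT.
have [W [N [valW maxN MN]]] :=
  localization_valuation (Kr_subring starP) maxM Kr_bezout_ratio.
have NM : contrD N = contrD M.
  rewrite -MN; apply/seteqP; split=> [d Nd|d []//].
  by split; last exact: Kr_toKX.
have [Qid [d Qd d0] _] := Qq.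
have [Wsub sub _] := valW; have [[NW N0 ND NMul] _ _] := maxN.
have WT : W <> setT.
  move=> WT; apply: (maximal_one Wsub maxN).
  have Nd : N (toKX d%:P) by move: (QM d Qd); rewrite -NM.
  rewrite -(mulVf (x := toKX d%:P)) ?toKX_eq0 ?polyC_eq0 //.
  by apply: NMul => //; rewrite WT.
have [NQ [_ NT _]] := contrD_quasi_prime starP valW maxN WT.
have NE : contrD N = Q by apply: Qmax => //; rewrite NM.
by exists M, W, N; split=> //; rewrite -NM.
Qed.

(** Zorn's lemma applies because [star_a] has finite type: an element of the
closure of the union of a chain is below finitely many elements, which all lie
in one member of the chain. *)
Lemma quasi_maximal_above P : quasi_prime (star_a star) P ->
  exists2 Q, quasi_maximal (star_a star) Q & P `<=` Q.
Proof.
move=> [Pq [_ PT _]].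
have [||Q [[Qq Q1] PQ Qmax]] := @zorn_above _
  [set Q | quasi_ideal (star_a star) Q /\ ~ Q 1] P.
- by split=> // P1; apply: PT; apply: (ideal_one _ P1); case: Pq.
- move=> S S0 SP St; split; last by move=> [I /SP[]].
  have Uid : ideal_of setT (\bigcup_(I in S) I).
    by apply: chain_ideal => // I /SP[[]].
  have [I0 SI0] := S0; have [[_ [d I0d d0] _] _] := SP I0 SI0.
  split=> //; first by exists d => //; exists I0.
  have nzU : nz_submod (toK @` \bigcup_(I in S) I).
    by apply: (nz_toK_ideal Uid _ d0); exists I0.
  apply/seteqP; split=> c; last first.
    by move=> Uc; apply: (sub_star_a starP) => //; exists c.
  move=> /(star_a_eab_le starP)[F [fgF FU cF]].
  suff [I SI FI] : exists2 I, S I & F `<=` toK @` I.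
    have [[_ _ IE] _] := SP I SI; exists I => //; rewrite -IE.
    by apply/(star_a_eab_le starP); exists F.
  have [nzF [s Fs]] := fgF.
  have [I SI sI] : exists2 I, S I & forall x, x \in s -> (toK @` I) x.
    have : forall x, x \in s -> (toK @` \bigcup_(I in S) I) x.
      by move=> x xs; apply: FU; rewrite Fs; apply: span_mem.
    elim: s {Fs} => [|x s IH] sU; first by exists I0.
    have [I SI sI] : exists2 I, S I & forall x, x \in s -> (toK @` I) x.
      by apply: IH => y ys; apply: sU; rewrite inE ys orbT.
    have [|a [J SJ Ja] xE] := sU x; first by rewrite mem_head.
    have [IJ|JI] := St I J SI SJ.
      exists J => // y; rewrite inE => /orP[/eqP ->|/sI[b Ib <-]].
        by exists a.
      by exists b => //; apply: IJ.
    exists I => // y; rewrite inE => /orP[/eqP ->|/sI //].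
    by exists a => //; apply: JI.
  exists I => //; rewrite Fs; apply: span_sub => //.
  have [[Iid [i Ii i0] _] _] := SP I SI; exact: nz_toK_ideal Iid Ii i0.
exists Q => //; split=> //; first by move=> QT; apply: Q1; rewrite QT.
move=> J Jq JT QJ; apply: Qmax => //; split=> // J1; apply: JT.
by apply: (ideal_one _ J1); case: Jq.
Qed.

Lemma star_range E : nz_submod E -> E `<=` range toK -> star E 1 ->
  star E = star (range toK).
Proof.
move=> nzE Er E1; have [nzr _] := nz_fg_range D.
apply/seteqP; split; first exact: (semistar_mono starP).
apply: star_closure => //; apply: range_sub => //.
exact: (semistar_submod starP).
Qed.

Lemma range_toK1 : range toK 1.
Proof. by exists 1; rewrite ?rmorph1. Qed.

(** A witness for [eab_le] cannot be cancelled under [star] itself, so the exact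
shape of the Dedekind-Mertens lemma matters here: its witness is a power of
[c(f)], whose closure contains [1]. *)
Lemma star_content_mul f g : f != 0 -> g != 0 ->
  star (contentK f) = star (range toK) ->
  star (contentK g) = star (range toK) ->
  star (contentK (f * g)) = star (range toK).
Proof.
move=> f0 g0 fE gE; have nzf := nz_contentK f0; have nzg := nz_contentK g0.
have nzfg : nz_submod (contentK (f * g)).
  by apply: nz_contentK; rewrite mulf_neq0.
have [nzr _] := nz_fg_range D.
have one_r : star (range toK) 1.
  by apply: (semistar_ext starP) => //; exact: range_toK1.
have nzE s : nz_submod (toK @` ideal_exp (content f) s).
  by have [] := nz_fg_ideal_exp s f0.
have one_E s : star (toK @` ideal_exp (content f) s) 1.
  elim: s => [//|s IH]; rewrite /= toK_mulset -[1]mulr1; apply: star_mul => //.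
  by rewrite -/(contentK f) fE.
apply: star_range => //; first exact: contentK_range.
have : star (contentK g) 1 by rewrite gE.
apply: star_closure => //.
have [_ _ SM _] := nzfg.
move=> c gc.
have : star (mulset (toK @` ideal_exp (content f) (size g).+1)
  (contentK g)) c.
  by rewrite -[c]mul1r; apply: star_mulr.
apply: star_closure => //; first exact: nz_mulset.
move=> x /(dedekind_mertensK (leqnn _)) xP; apply: (semistar_ext starP) => //.
have [S0 SD _ _] := nzfg.
by move: x xP; apply: mulset_ind => // _ b [a _ <-]; apply: SM.
Qed.

(** For [star_a], being a denominator of [Na] is a statement about the preorder,
where [eab_le_contentM] gives stability under products. *)
Lemma star_a_unit g : g != 0 ->
  star_a star (contentK g) = star_a star (range toK) <->
  eab_le [set 1] (contentK g).
Proof.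
move=> g0; have nzg := nz_contentK g0; have [nzr _] := nz_fg_range D.
split=> [gE|g1].
  have : star_a star (contentK g) 1.
    by rewrite gE; apply: (sub_star_a starP) => //; exact: range_toK1.
  move=> /(star_a_eab_le starP)[F [[nzF _] Fg F1]].
  by apply: (eab_le_trans starP nzF) => //; apply: eab_le_subset.
apply/seteqP; split; first exact/star_a_mono/contentK_range.
move=> x /(star_a_eab_le starP)[F [[nzF _] Fr xF]].
apply/(star_a_eab_le starP); exists (contentK g).
split=> //; first exact: nz_fg_contentK.
apply: (@eab_le_subl _ _ _ (mulset [set x] [set 1])).
  by move=> _ ->; rewrite -[X in mulset _ _ X]mulr1; apply: mulset_mem.
apply: (eab_le_trans starP (nz_mulset nzF nzg)) => //.
  exact: eab_le_mul.
apply: eab_le_subset => //; have [S0 SD SM _] := nzg.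
by apply: mulset_sub => // _ b /Fr[a _ <-]; apply: SM.
Qed.

Lemma eab_le_unit_mul f g : f != 0 -> g != 0 ->
  eab_le [set 1] (contentK f) -> eab_le [set 1] (contentK g) ->
  eab_le [set 1] (contentK (f * g)).
Proof.
move=> f0 g0 f1 g1; have nzf := nz_contentK f0; have nzg := nz_contentK g0.
have nzfg : nz_submod (contentK (f * g)).
  by apply: nz_contentK; rewrite mulf_neq0.
apply: (eab_le_trans starP (nz_mulset nzf nzg)) => //; last first.
  exact: eab_le_contentM.
apply: (@eab_le_subl _ _ _ (mulset [set 1] [set 1])); last exact: eab_le_mul.
by move=> _ ->; rewrite -[X in mulset _ _ X]mulr1; apply: mulset_mem.
Qed.

Section StarValuation.
Variables W N : set KX.
Hypotheses (valW : valuation_overring Kr W) (maxN : maximal_ideal W N).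
Local Notation V := (@KtoKX D @^-1` W).
Local Notation M := (@KtoKX D @^-1` N).

(** For [c = a / b], the quotient [c / f] is [a / (b f)], and [a] is in the
closure of the content of [b f]. *)
Lemma Kr_star_content (c : K) f : f != 0 -> star (contentK f) c ->
  Kr (KtoKX c / toKX f).
Proof.
move=> f0 fc; have [a [b [b0 cE]]] := fraction_repr c.
have bK : toK b != 0 by rewrite toK_eq0.
have -> : KtoKX c / toKX f = toKX a%:P / toKX (b%:P * f).
  rewrite cE -/(toK a) -/(toK b) fmorph_div /= !KtoKX_toK rmorphM.
  by rewrite invfM mulrA.
have bf0 : b%:P * f != 0 by rewrite mulf_neq0 ?polyC_eq0.
apply: (Kr_frac starP) => //.
apply: (eab_le_star starP); first exact: nz_contentK.
have nzbf := semistar_submod starP (nz_contentK bf0).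
apply: contentK_sub => // i; rewrite coefC; case: eqP => _; last first.
  by rewrite rmorph0; case: nzbf.
rewrite contentK_const (semistar_scale starP) //; last exact: nz_contentK.
by exists c => //; rewrite cE mulrC divfK.
Qed.

Lemma contraction_subring : subring_closed (mem V).
Proof.
have [/subringP[W1 WB WM] _ _] := valW.
apply/subringP; split=> [|x y Wx Wy|x y Wx Wy] /=.
- by rewrite rmorph1.
- by rewrite rmorphB; apply: WB.
- by rewrite rmorphM; apply: WM.
Qed.

Lemma contraction_star_valuation : star_valuation_overring star V.
Proof.
have [Wsub sub tot] := valW.
have [[_ N0 ND NM] _ _] := maxN.
split.
  split; first exact: contraction_subring.
    move=> _ [d _ <-]; rewrite /= KtoKX_toK.
    exact: (valuation_toKX starP valW).
  move=> x x0 /=; rewrite fmorphV; apply: tot.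
  by rewrite fmorph_eq0.
move=> F fgF x Fx.
have [d [f [d0 f0 dF]]] := nz_fg_scaled_contentK fgF.
have dK : toK d != 0 by rewrite toK_eq0.
have [nzF _] := fgF; have [F0 FD FM _] := nzF.
have [->|x0] := eqVneq x 0; first exact: mulset0.
set c := toK d * x; have c0 : c != 0 by rewrite mulf_neq0.
have fc : star (contentK f) c.
  by rewrite -dF (semistar_scale starP) //; exists x.
(* Otherwise every f_i / c is in N, hence f / c is, although c / f is in W. *)
have [i [fi Vi]] : exists i, f`_i != 0 /\ V (c / toK f`_i).
  apply: contrapT => nex; apply: (maximal_one Wsub maxN).
  have cK : KtoKX c != 0 by rewrite fmorph_eq0.
  have Ni i : N (toKX (f`_i)%:P / KtoKX c).
    have [->|fi] := eqVneq f`_i 0; first by rewrite polyC0 rmorph0 mul0r.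
    rewrite -KtoKX_toK -[_ / _]invrK invf_div.
    apply: (valuation_maximal valW maxN).
      apply: mulf_neq0; first exact: cK.
      by rewrite invr_eq0 fmorph_eq0 toK_eq0.
    by move=> Wi; apply: nex; exists i; rewrite /= fmorph_div.
  have Nf : N (toKX f / KtoKX c).
    rewrite toKX_expand mulr_suml; elim/big_ind : _ => // i _.
    rewrite mulrAC mulrC; apply: NM => //.
    exact: (valuation_toKX starP valW).
  have <- : KtoKX c / toKX f * (toKX f / KtoKX c) = 1.
    by rewrite mulrA divfK ?toKX_eq0 // divff.
  by apply: NM => //; apply/sub/Kr_star_content.
have Ff : F (toK f`_i / toK d).
  have : contentK f (toK f`_i) by exact: contentK_coef.
  by rewrite -dF => -[y Fy <-]; rewrite mulrAC (mulfV dK) mul1r.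
have -> : x = toK f`_i / toK d * (c / toK f`_i).
  rewrite [RHS]mulrC mulrA divfK ?toK_eq0 //.
  by rewrite /c mulrAC mulfV // mul1r.
exact: mulset_mem.
Qed.

Lemma contraction_maximal : maximal_ideal V M.
Proof.
have [Wsub _ _] := valW; have [[NW N0 ND NM] _ _] := maxN.
apply: local_maximal.
- exact: contraction_subring.
- split=> [x /= /NW //||x y Mx My|a x Va Mx] /=.
  + by rewrite rmorph0.
  + by rewrite rmorphD; apply: ND.
  + by rewrite rmorphM; apply: NM.
- by rewrite /= rmorph1; exact: (maximal_one Wsub maxN).
- by move=> x Vx Mx /=; rewrite fmorphV; apply: (valuation_inv valW maxN).
Qed.

Lemma contraction_dominates :
  dominates V M (loc (contrD N)) (loc_max (contrD N)).
Proof.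
have [Wsub _ _] := valW; have [W0 W1 WN WD WM] := subring_ops Wsub.
have [[NW N0 ND NM] _ _] := maxN.
have [[_ P0 PD PM] PT Pprime] := contrD_prime starP valW maxN.
have Winv s : ~ contrD N s -> W (KtoKX (toK s))^-1.
  move=> Ns; apply: (valuation_inv valW maxN).
    rewrite KtoKX_toK; exact: (valuation_toKX starP valW).
  by rewrite KtoKX_toK.
have Ws d : W (KtoKX (toK d)).
  by rewrite KtoKX_toK; exact: (valuation_toKX starP valW).
have locV : loc (contrD N) `<=` V.
  move=> _ [a [s [Ns ->]]] /=; rewrite fmorph_div.
  by apply: WM; [exact: Ws|exact: Winv].
have nz s : ~ contrD N s -> toK s != 0.
  by move=> Ns; rewrite toK_eq0; apply/eqP => s0; apply: Ns; rewrite s0.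
have P1 : ~ contrD N 1.
  by rewrite /contrD /= polyC1 rmorph1; exact: (maximal_one Wsub maxN).
split=> //; apply/seteqP; split.
  move=> x [+ [a [s [Ns xE]]]]; rewrite {x}xE => Mas.
  apply: mulset_mem; last by exists 1, s; rewrite rmorph1 mul1r.
  exists a => //; rewrite /contrD /= -KtoKX_toK -[toK a](divfK (nz s Ns)).
  rewrite rmorphM mulrC; apply: NM; [exact: Ws|exact: Mas].
apply: mulset_sub => [|x y [Mx Lx] [My Ly]|_ _ [a Na <-] [b [s [Ns ->]]]].
- split; first by rewrite /= rmorph0.
  by exists 0, 1; rewrite rmorph0 mul0r.
- split; first by rewrite /= rmorphD; apply: ND.
  move: Lx Ly => [a [s [Ns ->]]] [b [t [Nt ->]]].
  exists (a * t + b * s), (s * t); split; first by move=> /(Pprime _ _ I I)[].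
  by rewrite addf_div ?nz // rmorphD !rmorphM.
- split; last by exists (a * b), s; rewrite rmorphM mulrA.
  rewrite /= rmorphM mulrC; apply: NM; last by rewrite /= KtoKX_toK.
  by apply: locV; exists b, s.
Qed.

End StarValuation.
End Centers.

Theorem theorem4p3 (D : idomainType)
    (star : set {fraction D} -> set {fraction D})
    (star_semistar : semistar star)
    (star_nontrivial : ~ trivial_semistar star)
    (star_finite_type : finite_type star) :
  [/\ (* (1) *)
      (forall W N : set {fraction {poly {fraction D}}},
         valuation_overring (Kr star) W -> W <> setT -> maximal_ideal W N ->
         let N0 := contrD N in
         let N1 := contrDX N in
         [/\ N1 = poly_ext N0,
             N `&` Na star = extD N0 (Na star) /\
             extD N0 (Na star) = extDX N1 (Na star),
             N `&` Na (star_a star) = extD N0 (Na (star_a star)) /\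
             extD N0 (Na (star_a star)) = extDX N1 (Na (star_a star)),
             quasi_prime (star_a star) N0
           & quasi_prime star N0]),
      (* (2) *)
      (forall P : set D, quasi_prime (star_a star) P ->
         exists (Q : set D) (W N : set {fraction {poly {fraction D}}}),
           [/\ quasi_maximal (star_a star) Q,
               valuation_overring (Kr star) W, maximal_ideal W N,
               P `<=` Q & Q = contrD N]),
      (* (3) *)
      [set Q | quasi_maximal (star_a star) Q] `<=`
        [set contrD M | M in [set M | maximal_ideal (Kr star) M]]
    & (* (4) *)
      (forall Q : set D, quasi_maximal (star_a star) Q ->
         exists V M : set {fraction D},
           [/\ star_valuation_overring star V, maximal_ideal V M
             & dominates V M (loc Q) (loc_max Q)])].
Proof.
have starP := star_semistar.
have [nzr _] := nz_fg_range D.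
split.
- move=> W N valW WT maxN N0 N1.
  have N0q := contrD_quasi_prime starP valW maxN WT.
  split=> //; last exact: quasi_prime_star_a.
  + exact: (contrDX_poly_ext starP valW maxN).
  + apply: (contr_Na starP valW maxN).
    * by rewrite contentK1.
    * exact: star_content_mul.
    * move=> g g0 gE; apply: Kr_inv => //; apply: eab_le_star => //.
        exact: nz_contentK.
      by rewrite gE => _ ->; apply: (semistar_ext starP).
  + apply: (contr_Na starP valW maxN).
    * by rewrite contentK1.
    * move=> f g f0 g0 /(star_a_unit starP f0) f1 /(star_a_unit starP g0) g1.
      apply/(star_a_unit starP); first by rewrite mulf_neq0.
      exact: eab_le_unit_mul.
    * by move=> g g0 /(star_a_unit starP g0); apply: Kr_inv.
- move=> P Pq; have [Q Qmax PQ] := quasi_maximal_above starP Pq.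
  have [_ [W [N [_ _ valW maxN NQ]]]] :=
    Kr_valuation_center starP star_finite_type Qmax.
  by exists Q, W, N.
- move=> Q Qmax; have [M [_ [_ [maxM MQ _ _ _]]]] :=
    Kr_valuation_center starP star_finite_type Qmax.
  by exists M.
- move=> Q Qmax; have [_ [W [N [_ _ valW maxN <-]]]] :=
    Kr_valuation_center starP star_finite_type Qmax.
  exists (@KtoKX D @^-1` W), (@KtoKX D @^-1` N); split.
  + exact: contraction_star_valuation valW maxN.
  + exact: contraction_maximal valW maxN.
  + exact: contraction_dominates valW maxN.
Qed.
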